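(* Let $\Pi=\operatorname{Ext}^*_{\Pi A_2}(M,M)$, $M=S_1\oplus P_1\oplus P_2\oplus S_2$, be equipped with the $A_\infty$-structure obtained by homotopy transfer from the dg category $\operatorname{End}^*(\tilde M)$, as described in the context. Then $m_1=0$ and, apart from the operations $m_2$ with an identity morphism as an input (which are dictated by strict unitality), all of the non-trivial operations of $\Pi$ on basis morphisms are the following, together with their counterparts under the symmetry $\kappa$ which exchanges the indices $1$ and $2$ (that is, $S_1\leftrightarrow S_2$, $P_1\leftrightarrow P_2$, $p_1\leftrightarrow p_2$, $j_1\leftrightarrow j_2$, $\alpha\leftrightarrow\beta$, $u_1\leftrightarrow u_2$, $(12)\leftrightarrow(21)$, $(121)\leftrightarrow(212)$). The $m_2$ operations: $$m_2(j_1,p_2)=(21),\quad m_2(u_1^n,u_1^m)=u_1^{n+m},\quad m_2(\beta u_1^m,u_1^n)=\beta u_1^{n+m},$$ $$m_2(u_2^m,\beta u_1^n)=\beta u_1^{n+m},\quad m_2(\alpha u_2^m,\beta u_1^n)=u_1^{n+m+1}.$$ The higher operations: \begin{align*} & m_{2n+2k+5}((12),(212)^k,j_1,\beta u_1^{n+k+1},p_1,(212)^n,(21))=1_{P_2},\\ & m_{2n+3}((12),(212)^n,j_1,\beta u_1^n)=j_2,\\ & m_{2n+3}((212)^k,j_1,\beta u_1^n,p_1,(212)^{n-k})=1_{P_1},\\ & m_{2n+3}(u_1^k,p_1,(212)^n,j_1)=u_1^{k-n-1}\alpha,\\ & m_{2n+3}(u_2^k\beta,p_1,(212)^n,j_1)=u_2^{k-n},\\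 & m_{2n+4}(u_1^k,p_1,(212)^n,(21),j_2)=u_1^{k-n-1},\\ & m_{2n+4}(p_1,(212)^n,(21),j_2,u_1^k)=u_1^{k-n-1},\\ & m_{2n+4}(u_2^k\beta,p_1,(212)^n,(21),j_2)=u_2^{k-n-1}\beta,\\ & m_{2n+3}(u_2^n\beta,p_1,(212)^n,(21))=p_2,\\ & m_{2n+2}(u_1^n,p_1,(212)^n)=p_1,\\ & m_{2k+2n+4}((121)^k,j_2,u_1^{n+k+1},p_1,(212)^n,(21))=1_{P_2},\\ & m_{2n+4}((121)^{n+1},j_2,u_1^{n+1})=j_2,\\ & m_{2n+4}((212)^k,(21),j_2,u_1^{n+1},p_1,(212)^{n-k})=1_{P_1},\\ & m_{2m+3}(p_2,(121)^m,j_2,\alpha u_2^n)=u_2^{n-m},\\ & m_{2m+3}(p_2,(121)^m,j_2,u_1^n)=\beta u_1^{n-(m+1)},\\ & m_{2m+4}(p_1,(21),(121)^m,j_2,\alpha u_2^{n+1})=\alpha u_2^{n-m}. \end{align*} Here $k,m,n$ range over the non-negative integers for which all exponents occurring in the formula are non-negative.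
   Context: $k$ (as ground ring) is a field. An $A_\infty$-category has operations $m_d:\operatorname{Hom}(X_{d-1},X_d)\otimes\cdots\otimes\operatorname{Hom}(X_0,X_1)\to\operatorname{Hom}(X_0,X_d)[2-d]$, $d\ge1$, satisfying $\sum_{l,n}(-1)^{\ddagger_n}m_{d-l+1}(f_d,\ldots,m_l(f_{n+l},\ldots,f_{n+1}),f_n,\ldots,f_1)=0$ with $\ddagger_n=|f_n|+\cdots+|f_1|-n$. So inputs are written in composition order (rightmost applied first). It is strictly unital if $m_2(f,1)=f$, $(-1)^{|g|}m_2(1,g)=g$ and all $m_d$, $d\neq2$, vanish when an input is an identity. Signs are suppressed in the formulas for compositions, homotopies and operations below and in the claim (they are understood up to sign). **The algebra.** $\Pi A_2$ is the preprojective algebra of the $A_2$-quiver: the path algebra of the quiver with vertices $1,2$ and arrows $(12):1\to2$, $(21):2\to1$ modulo $(12)(21)=0=(21)(12)$. It has four indecomposable finitely generated modules: the one-dimensional simples $S_1,S_2$ at the two vertices and the projectives $P_1,P_2$ ($P_i$ spanned by the paths beginning at $i$). The arrows induce maps $(12):P_1\to P_2$ and $(21):P_2\to P_1$ of projectives. There are short exact sequences $$0\to S_1\xrightarrow{j_2}P_2\xrightarrow{p_2}S_2\to0,\qquad 0\to S_2\xrightarrow{j_1}P_1\xrightarrow{p_1}S_1\to0,$$ with $(12)=j_2p_1$, $(21)=j_1p_2$. Their classes span $\operatorname{Ext}^1(S_2,S_1)$ and $\operatorname{Ext}^1(S_1,S_2)$ and are denoted $\alpha:S_2\to S_1$ and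 $\beta:S_1\to S_2$, of degree $1$. All of $p_i,j_i,(12),(21)$ have degree $0$. Put $u_1=\alpha\beta$, $u_2=\beta\alpha$ (degree $2$), so $u_2\beta=\beta u_1$, $u_1\alpha=\alpha u_2$. **The category $\Pi$.** Objects: $S_1,S_2,P_1,P_2$; morphisms: $\operatorname{Ext}^*_{\Pi A_2}$. Basis of the morphism spaces ($n\ge0$): $\operatorname{Hom}(P_i,S_i)=\langle p_i\rangle$, $\operatorname{Hom}(S_1,P_2)=\langle j_2\rangle$, $\operatorname{Hom}(S_2,P_1)=\langle j_1\rangle$, $\operatorname{Hom}(P_1,P_2)=\langle(12)\rangle$, $\operatorname{Hom}(P_2,P_1)=\langle(21)\rangle$, $\operatorname{Hom}(P_i,P_i)=\langle1_{P_i}\rangle$, $\operatorname{Hom}(S_i,S_i)=\langle u_i^n\rangle$, $\operatorname{Hom}(S_1,S_2)=\langle\beta u_1^n\rangle$, $\operatorname{Hom}(S_2,S_1)=\langle\alpha u_2^n\rangle$; all other spaces are zero. Here $u_i^0=1_{S_i}$. Notation: $(212)=(21)\otimes(12)$, $(121)=(12)\otimes(21)$; e.g. $(212)^n=(21)\otimes(12)\otimes\cdots\otimes(21)\otimes(12)$ is a string of $2n$ consecutive inputs, empty for $n=0$. **The $A_\infty$-structure.** Indices $i$ of $S_i,P_i$ are taken in $\mathbb Z/2$. Let $Q_i=[\cdots\to P_1\xrightarrow{(12)}P_2\xrightarrow{(21)}P_1\to\cdots\to P_i]$ be the projective resolution of $S_i$, with $P_{i+j}$ in cohomological degree $-j$,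 $j\ge0$. Let $\tilde M=Q_1\oplus P_1\oplus P_2\oplus Q_2$. The dg category $\operatorname{End}^*(\tilde M)$ has composition $\mu$ and differential $df=d\circ f-(-1)^{|f|}f\circ d$; its cohomology is $\operatorname{Ext}^*(M)$. Given maps $i:\operatorname{Ext}^*(M)\to\operatorname{End}^*(\tilde M)$ and $p:\operatorname{End}^*(\tilde M)\to\operatorname{Ext}^*(M)$ of degree $0$ and $H:\operatorname{End}^*(\tilde M)\to\operatorname{End}^*(\tilde M)$ of degree $-1$ with $pi=1$, $1-ip=d(H)$, $H^2=0$, the transferred structure is $m_n=\sum_Tm_n^T$, $T$ ranging over planar rooted binary trees with $n$ leaves, where $m_n^T$ is the composite obtained by labelling leaves by $i$, branch points by $\mu$, internal edges by $H$ and the root by $p$. With this structure $\Pi$ is $A_\infty$-equivalent to $\operatorname{End}^*(\tilde M)$. The homotopy $H$ used is as follows (writing $S_i$ for $Q_i$ in subscripts). Define maps in $\operatorname{End}^*(\tilde M)$ whose non-zero components are identities: - $h^{(n)}_{S_iS_i}:Q_i\to Q_i$ of degree $-2n$, with components $(Q_i)_{-j}\to(Q_i)_{-j-2n}$, $j\ge0$; - $h^{(n)}_{S_iS_{i+1}}:Q_{i+1}\to Q_i$ of degree $-2n-1$, with components $(Q_{i+1})_{-j}\to(Q_i)_{-j-2n-1}$, $j\ge0$; - $h^{(n)}_{S_iP_i}:P_i\to(Q_i)_{-2n}$; $h^{(n)}_{S_iP_{i+1}}:P_{i+1}\to(Q_i)_{-2n-1}$; - $h^{(n)}_{P_iS_i}:(Q_i)_{-2n}\to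 P_i$; $h^{(n)}_{P_{i+1}S_i}:(Q_i)_{-2n-1}\to P_{i+1}$. On products of two (images under $i$ of) basis elements, $H$ is non-zero only for $H(p_1j_1)=h^{(0)}_{S_1S_2}$, $H(j_1(\beta u_1^n))=h^{(n)}_{P_1S_1}$, $H(p_1(21))=h^{(0)}_{S_1P_2}$, $H(j_2u_1^n)=h^{(n-1)}_{P_2S_1}$ ($n>0$), and the $1\leftrightarrow2$ counterparts of these. On products of one of the $h$-maps with a basis element, $H$ is non-zero only for $H(h^{(n)}_{S_1P_2}j_2)=h^{(n+1)}_{S_1S_1}$, $H(h^{(n)}_{S_1P_2}(12))=h^{(n+1)}_{S_1P_1}$ ($n\ge0$), $H(h^{(n)}_{S_1P_1}j_1)=h^{(n)}_{S_1S_2}$, $H(h^{(n)}_{S_1P_1}(21))=h^{(n)}_{S_1P_2}$ ($n\ge1$), $H((12)h^{(n)}_{P_1S_1})=h^{(n-1)}_{P_2S_1}$ ($n\ge1$), $H((21)h^{(n)}_{P_2S_1})=h^{(n)}_{P_1S_1}$ ($n\ge0$), and the $1\leftrightarrow2$ counterparts. $H$ is zero on the chosen cycles representing basis elements of $\operatorname{Ext}^*(M)$ and on all other products occurring in the tree formula. *)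

(* Defs.v *)
From HB Require Import structures.
From mathcomp Require Import all_boot all_order all_algebra.
Set Implicit Arguments. Unset Strict Implicit. Unset Printing Implicit Defensive.
Import Order.TTheory GRing.Theory Num.Theory.
Local Open Scope ring_scope.

(* A vertex is the parity of its index in Z/2: the vertex i + j is
   i (+) odd j, and ~~ i is i + 1. *)
Definition vertex := bool.
Definition v1 : vertex := true.
Definition v2 : vertex := false.

(* A finite-dimensional module over the path algebra of 1 <=> 2 modulo
   (12)(21) = 0 = (21)(12), given by the action of the algebra generators: the
   length zero paths [idem v] and the arrows [arr v] : v -> v + 1.  Vectors are
   rows, so [A *m B] means: first A, then B. *)
Record ppmod (k : fieldType) := PPMod {
  mdim : nat;
  idem : vertex -> 'M[k]_mdim;
  arr : vertex -> 'M[k]_mdim;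
  idem_idem : forall v w, idem v *m idem w = if v == w then idem v else 0;
  idem_sum : idem v1 + idem v2 = 1%:M;
  idem_arr : forall v, idem v *m arr v = arr v;
  arr_idem : forall v, arr v *m idem (~~ v) = arr v;
  arr_arr : forall v, arr v *m arr (~~ v) = 0 }.

Definition is_modmap (k : fieldType) (X Y : ppmod k)
    (F : 'M[k]_(mdim X, mdim Y)) : Prop :=
  (forall v, idem X v *m F = F *m idem Y v) /\
  (forall v, arr X v *m F = F *m arr Y v).

Lemma zeromod_eq (k : fieldType) (A B : 'M[k]_0) : A = B.
Proof. by apply/matrixP => -[]. Qed.

Definition zeromod (k : fieldType) : ppmod k :=
  @PPMod k 0 (fun _ => 0) (fun _ => 0)
    (fun _ _ => zeromod_eq _ _) (zeromod_eq _ _) (fun _ => zeromod_eq _ _)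
    (fun _ => zeromod_eq _ _) (fun _ => zeromod_eq _ _).

(* P_v has as basis the paths beginning at v: the row index 0 stands for the
   length zero path (ending at v), the row index 1 for the arrow leaving v
   (ending at v + 1). *)
Definition proj_idem (k : fieldType) (v w : vertex) : 'M[k]_2 :=
  \matrix_(i, j) ((i == j) && (w == v (+) (i == 1)))%:R.

Definition proj_arr (k : fieldType) (v w : vertex) : 'M[k]_2 :=
  \matrix_(i, j) [&& w == v, i == 0 & j == 1]%:R.

Ltac proj_tac :=
  intros; apply/matrixP;
  do 2 (case; case=> [|[|//]] ?);
  rewrite !mxE ?big_ord_recl ?big_ord0 ?mxE;
  repeat match goal with v : vertex |- _ => destruct v end;
  by rewrite ?mxE /= ?(mulr0, mul0r, mulr1, addr0, add0r).

Lemma proj_idem_idem (k : fieldType) (u v w : vertex) :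
  proj_idem k u v *m proj_idem k u w = if v == w then proj_idem k u v else 0.
Proof.
by case: eqP => [<-|/eqP]; move: u v w => [] [] // => [|[]|[]|] //; proj_tac.
Qed.

Lemma proj_idem_sum (k : fieldType) (u : vertex) :
  proj_idem k u v1 + proj_idem k u v2 = 1%:M.
Proof. by proj_tac. Qed.

Lemma proj_idem_arr (k : fieldType) (u v : vertex) :
  proj_idem k u v *m proj_arr k u v = proj_arr k u v.
Proof. by proj_tac. Qed.

Lemma proj_arr_idem (k : fieldType) (u v : vertex) :
  proj_arr k u v *m proj_idem k u (~~ v) = proj_arr k u v.
Proof. by proj_tac. Qed.

Lemma proj_arr_arr (k : fieldType) (u v : vertex) :
  proj_arr k u v *m proj_arr k u (~~ v) = 0.
Proof. by proj_tac. Qed.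

Definition projmod (k : fieldType) (v : vertex) : ppmod k :=
  PPMod (@proj_idem_idem k v) (proj_idem_sum k v) (proj_idem_arr k v)
    (proj_arr_idem k v) (proj_arr_arr k v).

(* The map P_v -> P_(v+1) induced by an arrow: it sends the length zero path at
   v to the path v + 1 -> v, and the path v -> v + 1 to 0.  Like [pid_mx], it is
   given for all sizes, and is 0 as soon as one of the modules is 0. *)
Definition arrow_mx (k : fieldType) (m n : nat) : 'M[k]_(m, n) :=
  \matrix_(i, j) ((i == 0%N :> nat) && (j == 1%N :> nat))%:R.

Definition obj : Type := (vertex + vertex)%type.
Definition objS (v : vertex) : obj := inl v.   (* S_v *)
Definition objP (v : vertex) : obj := inr v.   (* P_v *)

(* The cohomological degree n part of the summand of M~ that represents x:
   the projective resolution Q_v for x = S_v, the module P_v for x = P_v. *)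
Definition mterm (k : fieldType) (x : obj) (n : int) : ppmod k :=
  match x with
  | inl v => if n <= 0 then projmod k (v (+) odd `|n|%N) else zeromod k
  | inr v => if n == 0 then projmod k v else zeromod k
  end.

(* Families of matrices with a component from the degree n part of x to the
   degree m part of y, for all x, y, n and m.  Morphisms of the dg category are
   the families that satisfy [is_hom] below. *)
Definition fam (k : fieldType) : Type :=
  forall (x y : obj) (n m : int), 'M[k]_(mdim (mterm k x n), mdim (mterm k y m)).

Definition fam0 (k : fieldType) : fam k := fun x y n m => 0.
Definition fadd (k : fieldType) (f g : fam k) : fam k :=
  fun x y n m => f x y n m + g x y n m.
Definition fscale (k : fieldType) (c : k) (f : fam k) : fam k :=
  fun x y n m => c *: f x y n m.

Definition sgn (k : fieldType) (d : int) : k := (-1) ^+ `|d|%N.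

(* f is a morphism of degree d from x to y. *)
Definition is_hom (k : fieldType) (x y : obj) (d : int) (f : fam k) : Prop :=
  (forall x' y' n m,
     ~~ [&& x' == x, y' == y & m == n + d] -> f x' y' n m = 0) /\
  (forall n m, is_modmap (f x y n m)).

(* The composite g o f, where f has degree d. *)
Definition fcomp (k : fieldType) (d : int) (g f : fam k) : fam k :=
  fun x z n m => \sum_(y : obj) f x y n (n + d) *m g y z (n + d) m.

(* The differential of M~; on the summands P_v it is 0 because all its
   components have a zero source or target. *)
Definition diffM (k : fieldType) : fam k :=
  fun x y n m => if (x == y) && (m == n + 1) then arrow_mx k _ _ else 0.

(* df = d o f - (-1)^|f| f o d for f of degree d. *)
Definition dEnd (k : fieldType) (d : int) (f : fam k) : fam k :=
  fadd (fcomp d (diffM k) f) (fscale (- sgn k d) (fcomp 1 f (diffM k))).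

(* The degree d families from x to y all of whose components between non-zero
   modules are identities, resp. maps induced by arrows. *)
Definition id_fam (k : fieldType) (x y : obj) (d : int) : fam k :=
  fun x' y' n m =>
    if [&& x' == x, y' == y & m == n + d] then pid_mx (mdim (mterm k x' n))
    else 0.

Definition arrow_fam (k : fieldType) (x y : obj) (d : int) : fam k :=
  fun x' y' n m =>
    if [&& x' == x, y' == y & m == n + d] then arrow_mx k _ _ else 0.

(* Equality up to the sign of each component. *)
Definition eqpm (k : fieldType) (f g : fam k) : Prop :=
  forall x y n m, f x y n m = g x y n m \/ f x y n m = - g x y n m.

Inductive basis : Type :=
| Bp of vertex           (* p_v : P_v -> S_v *)
| Bj of vertex           (* j_v : S_(v+1) -> P_v *)
| Ba of vertex           (* (12) : P_1 -> P_2 for v = 1, (21) for v = 2 *)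
| B1 of vertex           (* 1_(P_v) *)
| Bu of vertex & nat     (* u_v ^ n *)
| Bx of vertex & nat.    (* S_v -> S_(v+1): beta u_1^n = u_2^n beta for v = 1,
                            alpha u_2^n = u_1^n alpha for v = 2 *)

Lemma basis_dec (b c : basis) : {b = c} + {b <> c}.
Proof. by decide equality; apply: eq_comparable. Qed.
HB.instance Definition _ := hasDecEq.Build basis (compareP basis_dec).

Definition src (b : basis) : obj :=
  match b with
  | Bp v => objP v | Bj v => objS (~~ v) | Ba v => objP v | B1 v => objP v
  | Bu v _ => objS v | Bx v _ => objS v
  end.

Definition tgt (b : basis) : obj :=
  match b with
  | Bp v => objS v | Bj v => objP v | Ba v => objP (~~ v) | B1 v => objP v
  | Bu v _ => objS v | Bx v _ => objS (~~ v)
  end.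

Definition deg (b : basis) : int :=
  match b with Bu _ n => n.*2%:Z | Bx _ n => n.*2.+1%:Z | _ => 0 end.

Definition id_basis (x : obj) : basis :=
  match x with inl v => Bu v 0 | inr v => B1 v end.

Definition is_id (b : basis) : bool := b == id_basis (src b).

(* The basis of Ext^d(x, y), which has at most one element. *)
Definition ext_basis (x y : obj) (d : int) : seq basis :=
  match x, y with
  | inr v, inl w => if (v == w) && (d == 0) then [:: Bp v] else [::]
  | inl v, inr w => if (v == ~~ w) && (d == 0) then [:: Bj w] else [::]
  | inr v, inr w =>
      if d == 0 then [:: if v == w then B1 v else Ba v] else [::]
  | inl v, inl w =>
      if d is Posz n then
        if odd n == (v != w) then [:: if odd n then Bx v n./2 else Bu v n./2]
        else [::]
      else [::]
  end.

Lemma mem_ext_basis (x y : obj) (d : int) (b : basis) :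
  (b \in ext_basis x y d) = [&& src b == x, tgt b == y & deg b == d].
Proof.
apply/idP/and3P.
  case: x y d => [] v [] w [n|n] //=.
  - case: ifP => [/eqP|//]; case: ifP => on; rewrite inE => vw /eqP -> /=;
      split=> //; apply/eqP; rewrite ?[RHS]odd_double_half.
    + by case: v w vw => [] [].
    + by congr Posz; rewrite -[RHS]odd_double_half on.
    + by case: v w vw => [] [].
    + by congr Posz; rewrite -[RHS]odd_double_half on.
  - by case: andP => [[/eqP-> /eqP->]|//]; rewrite inE => /eqP->.
  - by rewrite andbF.
  - by case: andP => [[/eqP-> /eqP->]|//]; rewrite inE => /eqP->.
  - by rewrite andbF.
  - case: eqP => [->|//]; rewrite inE => /eqP ->.
    by case: v w => [] [].
case=> /eqP <- /eqP <- /eqP <-; case: b => [v|v|v|v|v n|v n] /=.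
- by rewrite !eqxx inE.
- by rewrite !eqxx inE.
- by case: v; rewrite inE.
- by rewrite !eqxx inE.
- by rewrite odd_double eqxx /= doubleK inE.
- by rewrite odd_double; case: v; rewrite /= uphalf_double inE.
Qed.

(* Ext^d(x, y) is the vector space with basis [ext_basis x y d].  The linear map
   i is given by its values on the basis; [p f b] is the coefficient of the
   basis element b in p f.  [ipmap i p x y d f] is i (p f) for f of degree d
   from x to y. *)
Definition ipmap (k : fieldType) (i : basis -> fam k) (p : fam k -> basis -> k)
    (x y : obj) (d : int) (f : fam k) : fam k :=
  fun x' y' n m => \sum_(b <- ext_basis x y d) p f b *: i b x' y' n m.

Record homotopy_retract (k : fieldType) (i : basis -> fam k)
    (p : fam k -> basis -> k) (H : fam k -> fam k) : Prop := HomotopyRetract {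
  i_hom : forall b, is_hom (src b) (tgt b) (deg b) (i b);
  i_cycle : forall b, dEnd (deg b) (i b) = fam0 k;
  p_linear : forall x y d (c : k) f g, is_hom x y d f -> is_hom x y d g ->
    forall b, p (fadd (fscale c f) g) b = c * p f b + p g b;
  p_hom : forall x y d f, is_hom x y d f ->
    forall b, b \notin ext_basis x y d -> p f b = 0;
  p_boundary : forall x y d f, is_hom x y d f ->
    forall b, p (dEnd d f) b = 0;
  H_linear : forall x y d (c : k) f g, is_hom x y d f -> is_hom x y d g ->
    H (fadd (fscale c f) g) = fadd (fscale c (H f)) (H g);
  H_hom : forall x y d f, is_hom x y d f -> is_hom x y (d - 1) (H f);
  pi_id : forall b c, p (i b) c = (b == c)%:R;
  ip_homotopy : forall x y d f, is_hom x y d f ->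
    fadd f (fscale (- 1) (ipmap i p x y d f)) =
    fadd (dEnd (d - 1) (H f)) (H (dEnd d f));
  H_H : forall x y d f, is_hom x y d f -> H (H f) = fam0 k }.

(* The standard cycles representing the basis.  The components of a cycle
   representing beta u_1^n or alpha u_2^n have to alternate in sign. *)
Definition cycle_shape (k : fieldType) (b : basis) : fam k :=
  match b with
  | Bj _ | Ba _ => arrow_fam k (src b) (tgt b) (deg b)
  | _ => id_fam k (src b) (tgt b) (deg b)
  end.

Definition chosen_cycles (k : fieldType) (i : basis -> fam k) : Prop :=
  (forall b, eqpm (i b) (cycle_shape k b)) /\
  (forall x, i (id_basis x) = id_fam k x x 0).

(* The maps h, with w = v + 1. *)
Inductive hindex : Type :=
| hSvSv of vertex & nat   (* h^(n)_(S_v S_v) : Q_v -> Q_v *)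
| hSvSw of vertex & nat   (* h^(n)_(S_v S_w) : Q_w -> Q_v *)
| hSvPv of vertex & nat   (* h^(n)_(S_v P_v) : P_v -> Q_v *)
| hSvPw of vertex & nat   (* h^(n)_(S_v P_w) : P_w -> Q_v *)
| hPvSv of vertex & nat   (* h^(n)_(P_v S_v) : Q_v -> P_v *)
| hPwSv of vertex & nat.  (* h^(n)_(P_w S_v) : Q_v -> P_w *)

Definition hsrc (h : hindex) : obj :=
  match h with
  | hSvSv v _ => objS v | hSvSw v _ => objS (~~ v)
  | hSvPv v _ => objP v | hSvPw v _ => objP (~~ v)
  | hPvSv v _ => objS v | hPwSv v _ => objS v
  end.

Definition htgt (h : hindex) : obj :=
  match h with
  | hSvSv v _ => objS v | hSvSw v _ => objS v
  | hSvPv v _ => objS v | hSvPw v _ => objS v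
  | hPvSv v _ => objP v | hPwSv v _ => objP (~~ v)
  end.

Definition hdeg (h : hindex) : int :=
  match h with
  | hSvSv _ n | hSvPv _ n => - n.*2%:Z
  | hSvSw _ n | hSvPw _ n => - n.*2.+1%:Z
  | hPvSv _ n => n.*2%:Z
  | hPwSv _ n => n.*2.+1%:Z
  end.

Definition hmap (k : fieldType) (h : hindex) : fam k :=
  id_fam k (hsrc h) (htgt h) (hdeg h).

(* h^(0)_(S_v S_v) = 1 and h^(0)_(S_v P_v) = p_v are not values of H. *)
Definition h_occurs (h : hindex) : bool :=
  match h with hSvSv _ 0 | hSvPv _ 0 => false | _ => true end.

(* H(g f), H(h f) and H(g h) for g, f in the basis and h a map as above; None
   stands for 0.  The vertices that are not read off are determined by
   composability. *)
Definition H_bb (g f : basis) : option hindex :=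
  match g, f with
  | Bp v, Bj _ => Some (hSvSw v 0)
  | Bj v, Bx _ n => Some (hPvSv v n)
  | Bp v, Ba _ => Some (hSvPw v 0)
  | Bj w, Bu v n.+1 => Some (hPwSv v n)
  | _, _ => None
  end.

Definition H_hb (h : hindex) (f : basis) : option hindex :=
  match h, f with
  | hSvPw v n, Bj _ => Some (hSvSv v n.+1)
  | hSvPw v n, Ba _ => Some (hSvPv v n.+1)
  | hSvPv v n.+1, Bj _ => Some (hSvSw v n.+1)
  | hSvPv v n.+1, Ba _ => Some (hSvPw v n.+1)
  | _, _ => None
  end.

Definition H_bh (g : basis) (h : hindex) : option hindex :=
  match g, h with
  | Ba _, hPvSv v n.+1 => Some (hPwSv v n)
  | Ba _, hPwSv v n => Some (hPvSv v n)
  | _, _ => None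
  end.

Definition is_value (k : fieldType) (o : option hindex) (f : fam k) : Prop :=
  match o with Some h => eqpm f (hmap k h) | None => f = fam0 k end.

Record chosen_homotopy (k : fieldType) (i : basis -> fam k)
    (H : fam k -> fam k) : Prop := ChosenHomotopy {
  H_cycle : forall b, H (i b) = fam0 k;
  H_prod_bb : forall g f, src g = tgt f ->
    is_value (H_bb g f) (H (fcomp (deg f) (i g) (i f)));
  H_prod_hb : forall h f (y : fam k), h_occurs h -> hsrc h = tgt f ->
    eqpm y (hmap k h) -> is_value (H_hb h f) (H (fcomp (deg f) y (i f)));
  H_prod_bh : forall g h (y : fam k), h_occurs h -> src g = htgt h ->
    eqpm y (hmap k h) -> is_value (H_bh g h) (H (fcomp (hdeg h) (i g) y));
  H_prod_hh : forall h h' (y y' : fam k), h_occurs h -> h_occurs h' ->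
    hsrc h = htgt h' -> eqpm y (hmap k h) -> eqpm y' (hmap k h') ->
    H (fcomp (hdeg h') y y') = fam0 k }.

Inductive tree : Type := Leaf | Node of tree & tree.

Fixpoint leaves (T : tree) : nat :=
  match T with Leaf => 1 | Node l r => leaves l + leaves r end.

Fixpoint trees_rec (fuel n : nat) : seq tree :=
  if fuel is fuel'.+1 then
    if n == 1%N then [:: Leaf]
    else flatten [seq [seq Node l r | l <- trees_rec fuel' s,
                                      r <- trees_rec fuel' (n - s)]
                 | s <- iota 1 n.-1]
  else [::].

Definition trees (n : nat) : seq tree := trees_rec n n.

Lemma tree_dec (T U : tree) : {T = U} + {T <> U}.
Proof. by decide equality. Qed.
HB.instance Definition _ := hasDecEq.Build tree (compareP tree_dec).

Lemma leaves_gt0 (T : tree) : (0 < leaves T)%N.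
Proof. by elim: T => //= l IHl r _; rewrite addn_gt0 IHl. Qed.

Lemma mem_trees_rec (fuel n : nat) (T : tree) :
  (n <= fuel)%N -> (T \in trees_rec fuel n) = (leaves T == n).
Proof.
elim: fuel n T => [|fuel IH] n T.
  by rewrite leqn0 => /eqP ->; rewrite in_nil; case: leaves (leaves_gt0 T).
move=> len /=; case: eqP => [->|/eqP n1].
  rewrite inE; case: T => [|l r]; first by rewrite !eqxx.
  have -> : (Node l r == Leaf) = false by apply/eqP.
  apply/esym/negbTE => /=.
  by move: (leaves_gt0 l) (leaves_gt0 r); case: leaves => // a;
    case: leaves => // b; rewrite addnS.
apply/flatten_mapP/eqP => [[s]|].
  rewrite mem_iota => /andP[s0 sn] /allpairsP[[l r] /= [lin rin ->]] /=.
  have sn' : (s < n)%N by case: n sn {len n1 rin} => //; rewrite ltnNge s0.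
  rewrite IH in lin; last by rewrite -ltnS (leq_trans sn').
  rewrite IH in rin; last first.
    by rewrite -ltnS (leq_trans _ len) // ltn_subrL s0 (leq_ltn_trans _ sn').
  by rewrite (eqP lin) (eqP rin) subnKC // ltnW.
case: T => [/esym/eqP|l r /= lr]; first by rewrite (negbTE n1).
have l0 := leaves_gt0 l; have r0 := leaves_gt0 r.
exists (leaves l).
  rewrite mem_iota l0 /= add1n prednK -lr ?addn_gt0 ?l0 //.
  by rewrite -[X in (X < _)%N]addn0 ltn_add2l.
have lln : (leaves l < n)%N by rewrite -lr -[X in (X < _)%N]addn0 ltn_add2l.
apply/allpairsP; exists (l, r); split=> //=.
  by rewrite IH // -ltnS (leq_trans lln).
rewrite -lr addKn IH // -ltnS (leq_trans _ len) // -lr.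
by rewrite -[X in (X < _)%N]add0n ltn_add2r.
Qed.

Lemma mem_trees (n : nat) (T : tree) : (T \in trees n) = (leaves T == n).
Proof. exact: mem_trees_rec. Qed.

Lemma uniq_trees_rec (fuel n : nat) :
  (n <= fuel)%N -> uniq (trees_rec fuel n).
Proof.
elim: fuel n => [|fuel IH] n len //=; case: eqP => // n1.
have size_s s : s \in iota 1 n.-1 -> (s <= fuel)%N /\ (n - s <= fuel)%N.
  rewrite mem_iota => /andP[s0 sn].
  have sn' : (s < n)%N by case: n sn {len n1} => //; rewrite ltnNge s0.
  split; first by rewrite -ltnS (leq_trans sn').
  by rewrite -ltnS (leq_trans _ len) // ltn_subrL s0 (leq_ltn_trans _ sn').
have: uniq (iota 1 n.-1) by apply: iota_uniq.
elim: (iota 1 n.-1) size_s => //= s ss IHs size_s /andP[sss uss].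
have [sf nsf] := size_s s (mem_head _ _).
rewrite cat_uniq IHs ?andbT //; last first.
  by move=> t tss; apply: size_s; rewrite inE tss orbT.
rewrite allpairs_uniq ?IH //=; last by move=> [l r] [l' r'] _ _ /= [-> ->].
apply/hasPn => T /flatten_mapP[t tss /allpairsP[[l r] /= [lin rin ->]]].
apply/negP => /allpairsP[[l' r'] /= [lin' rin' [ll' _]]].
have [tf ntf] : (t <= fuel)%N /\ (n - t <= fuel)%N.
  by apply: size_s; rewrite inE tss orbT.
move: lin lin'; rewrite !mem_trees_rec // -ll' => /eqP -> /eqP ts.
by rewrite -ts tss in sss.
Qed.

Lemma uniq_trees (n : nat) : uniq (trees n).
Proof. exact: uniq_trees_rec. Qed.

(* Signs: the relations with the signs (-1)^(dagger_n) hold for the dg category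
   End^*(M~) with m_1 f = (-1)^|f| df and m_2(g, f) = (-1)^|f| g o f.  In these
   conventions the homotopy is f |-> (-1)^|f| H f, as then
   m_1 T + T m_1 = - (1 - ip) for T that map, and the tree formula has no
   further signs.  A pair (d, f) is a morphism f of degree d. *)
Definition mu2 (k : fieldType) (g f : int * fam k) : int * fam k :=
  (g.1 + f.1, fscale (sgn k f.1) (fcomp f.1 g.2 f.2)).

Definition Hmap (k : fieldType) (H : fam k -> fam k) (f : int * fam k) :
    int * fam k :=
  (f.1 - 1, fscale (sgn k f.1) (H f.2)).

(* Lists of inputs [:: f_d; ...; f_1] are in composition order.  [tree_mu]
   is the labelled tree without the label p of the root. *)
Fixpoint tree_mu (k : fieldType) (i : basis -> fam k) (H : fam k -> fam k)
    (T : tree) (bs : seq basis) : int * fam k :=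
  match T with
  | Leaf => if bs is b :: _ then (deg b, i b) else (0, fam0 k)
  | Node l r =>
      let edge t f := if t is Leaf then f else Hmap H f in
      mu2 (edge l (tree_mu i H l (take (leaves l) bs)))
          (edge r (tree_mu i H r (drop (leaves l) bs)))
  end.

(* [m_op i p H [:: f_d; ...; f_1] c] is the coefficient of the basis element c
   in m_d(f_d, ..., f_1). *)
Definition m_op (k : fieldType) (i : basis -> fam k) (p : fam k -> basis -> k)
    (H : fam k -> fam k) (bs : seq basis) (c : basis) : k :=
  if bs is [:: b] then p (fscale (sgn k (deg b)) (dEnd (deg b) (i b))) c
  else \sum_(T <- trees (size bs)) p (tree_mu i H T bs).2 c.

Definition composable (bs : seq basis) : bool :=
  sorted (fun g f => src g == tgt f) bs.

Definition p1 := Bp v1.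
Definition p2 := Bp v2.
Definition j1 := Bj v1.
Definition j2 := Bj v2.
Definition a12 := Ba v1.
Definition a21 := Ba v2.
Definition oneP1 := B1 v1.
Definition oneP2 := B1 v2.
Definition u1 (n : nat) := Bu v1 n.
Definition u2 (n : nat) := Bu v2 n.
Definition beta_u (n : nat) := Bx v1 n.   (* beta u_1^n = u_2^n beta *)
Definition alpha_u (n : nat) := Bx v2 n.  (* alpha u_2^n = u_1^n alpha *)

Definition s212 (n : nat) : seq basis := flatten (nseq n [:: a21; a12]).
Definition s121 (n : nat) : seq basis := flatten (nseq n [:: a12; a21]).

Definition kappa (b : basis) : basis :=
  match b with
  | Bp v => Bp (~~ v) | Bj v => Bj (~~ v) | Ba v => Ba (~~ v)
  | B1 v => B1 (~~ v) | Bu v n => Bu (~~ v) n | Bx v n => Bx (~~ v) n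
  end.

(* [op_list bs c]: the operation with inputs bs and output c is in the list. *)
Inductive op_list : seq basis -> basis -> Prop :=
| op2_jp : op_list [:: j1; p2] a21
| op2_uu n m : op_list [:: u1 n; u1 m] (u1 (n + m))
| op2_bu m n : op_list [:: beta_u m; u1 n] (beta_u (n + m))
| op2_ub m n : op_list [:: u2 m; beta_u n] (beta_u (n + m))
| op2_ab m n : op_list [:: alpha_u m; beta_u n] (u1 (n + m).+1)
| op_1 n k :
    op_list ([:: a12] ++ s212 k ++ [:: j1; beta_u (n + k).+1; p1]
               ++ s212 n ++ [:: a21]) oneP2
| op_2 n : op_list ([:: a12] ++ s212 n ++ [:: j1; beta_u n]) j2
| op_3 n k : (k <= n)%N ->
    op_list (s212 k ++ [:: j1; beta_u n; p1] ++ s212 (n - k)) oneP1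
| op_4 n k : (n + 1 <= k)%N ->
    op_list ([:: u1 k; p1] ++ s212 n ++ [:: j1]) (alpha_u (k - n - 1))
| op_5 n k : (n <= k)%N ->
    op_list ([:: beta_u k; p1] ++ s212 n ++ [:: j1]) (u2 (k - n))
| op_6 n k : (n + 1 <= k)%N ->
    op_list ([:: u1 k; p1] ++ s212 n ++ [:: a21; j2]) (u1 (k - n - 1))
| op_7 n k : (n + 1 <= k)%N ->
    op_list ([:: p1] ++ s212 n ++ [:: a21; j2; u1 k]) (u1 (k - n - 1))
| op_8 n k : (n + 1 <= k)%N ->
    op_list ([:: beta_u k; p1] ++ s212 n ++ [:: a21; j2]) (beta_u (k - n - 1))
| op_9 n : op_list ([:: beta_u n; p1] ++ s212 n ++ [:: a21]) p2
| op_10 n : op_list ([:: u1 n; p1] ++ s212 n) p1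
| op_11 n k :
    op_list (s121 k ++ [:: j2; u1 (n + k).+1; p1] ++ s212 n ++ [:: a21]) oneP2
| op_12 n : op_list (s121 n.+1 ++ [:: j2; u1 n.+1]) j2
| op_13 n k : (k <= n)%N ->
    op_list (s212 k ++ [:: a21; j2; u1 n.+1; p1] ++ s212 (n - k)) oneP1
| op_14 m n : (m <= n)%N ->
    op_list ([:: p2] ++ s121 m ++ [:: j2; alpha_u n]) (u2 (n - m))
| op_15 m n : (m + 1 <= n)%N ->
    op_list ([:: p2] ++ s121 m ++ [:: j2; u1 n]) (beta_u (n - (m + 1)))
| op_16 m n : (m <= n)%N ->
    op_list ([:: p1; a21] ++ s121 m ++ [:: j2; alpha_u n.+1]) (alpha_u (n - m)).

Definition in_list (bs : seq basis) (c : basis) : Prop :=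
  op_list bs c \/ op_list [seq kappa b | b <- bs] (kappa c).

Definition equals_pm (k : fieldType) (a : basis -> k) (c : basis) : Prop :=
  exists s : bool, forall b, a b = (-1) ^+ s * (b == c)%:R.

(* Main.v *)
(* Every tree reduces to an iterated product of basis elements in which H is
   applied at each internal edge.  Such an edge is non-zero on very few words,
   and each of these words is evaluated by a single comb, so that
   m_d(f_d, ..., f_1) is the class of a sum over the splittings of f_d, ..., f_1
   into two such words.  Most of the words that have a splitting are excluded
   since Ext^* vanishes in their degree.  The remaining ones have a unique
   splitting, except for p a ... a j x with x in Ext^*(S, S), where all
   splittings contribute and only their sum is a cycle.  That it is one follows
   from m_1 (H w) = - w for the products w to which H is applied, as these are
   boundaries: the sum over the splittings telescopes.  Finally, a cycle in a
   degree in which Ext^* does not vanish is a multiple of the standard one, and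
   the factor, which is 1 or -1, is read off from a single component. *)
Require Import Defs.
From mathcomp Require Import all_boot all_order all_algebra.
From mathcomp Require Import zify.
From Stdlib Require Import FunctionalExtensionality.
Set Implicit Arguments. Unset Strict Implicit. Unset Printing Implicit Defensive.
Import Order.TTheory GRing.Theory Num.Theory.
Local Open Scope ring_scope.

(** * The dg category of families *)

(** The chosen cycles and the values of H are prescribed only up to a sign in each component, so the
    terms of a sum over splittings could a priori cancel. The component from degree -d to degree 0
    avoids this: for p a ... a j x only the splitting after p reaches it, since every later right
    factor maps degree -d to a positive degree, where all modules vanish.

    The formula m_1 (H w) = - w needs w to be closed and Ext^* to vanish in its degree. Closedness
    propagates along the comb: by associativity the boundary of w contains a product of two arrows,
    or of an arrow and some j, which is 0. Ext^* vanishes because w has negative degree, or goes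
    from S to P in positive degree, or, for the products p a and p j of degree 0, because the
    vertices do not match.

    Parities are kept symbolic. A string of arrows is given by its final vertex and its length, an
    element of Ext^*(S, S) by its source and degree; the formulas of the list then fall into seven
    families. *)

Section DgCategory.
Variable k : fieldType.
Implicit Types (f g h : fam k) (x y z : obj) (d e n m : int).

Lemma fam_ext f g : (forall x y n m, f x y n m = g x y n m) -> f = g.
Proof. by move=> fg; do 4 (apply: functional_extensionality_dep => ?). Qed.

Lemma sgnE d : sgn k d = (-1) ^ d.
Proof.
by case: d => n //; rewrite /sgn NegzE abszN /= -invr_expz invr_sign.
Qed.

Lemma sgnD d e : sgn k (d + e) = sgn k d * sgn k e.
Proof. by rewrite !sgnE expfzDr // oppr_eq0 oner_eq0. Qed.

Lemma sgn1 : sgn k 1 = -1.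
Proof. by rewrite /sgn expr1. Qed.

Lemma sgnN1 : sgn k (- 1) = -1.
Proof. by rewrite /sgn expr1. Qed.

Lemma sgnK d : sgn k d * sgn k d = 1.
Proof. by rewrite /sgn -signr_odd -expr2 sqrr_sign. Qed.

Lemma sgn_pm d : sgn k d = 1 \/ sgn k d = -1.
Proof. by rewrite /sgn -signr_odd; case: (odd _); [right|left]. Qed.

Lemma fscale1 f : fscale 1 f = f.
Proof. by apply: fam_ext => *; apply: scale1r. Qed.

Lemma fscaleA (a b : k) f : fscale a (fscale b f) = fscale (a * b) f.
Proof. by apply: fam_ext => *; apply: scalerA. Qed.

Lemma fscale0 (a : k) : fscale a (fam0 k) = fam0 k.
Proof. by apply: fam_ext => *; apply: scaler0. Qed.

Lemma fscale_add (a : k) f g :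
  fscale a (fadd f g) = fadd (fscale a f) (fscale a g).
Proof. by apply: fam_ext => *; apply: scalerDr. Qed.

Lemma fadd0 f : fadd f (fam0 k) = f.
Proof. by apply: fam_ext => *; apply: addr0. Qed.

Lemma add0f f : fadd (fam0 k) f = f.
Proof. by apply: fam_ext => *; apply: add0r. Qed.

Lemma fcompA d e h g f :
  fcomp d (fcomp e h g) f = fcomp (d + e) h (fcomp d g f).
Proof.
apply: fam_ext => x z n m; rewrite /fcomp addrA.
under eq_bigr do rewrite mulmx_sumr.
rewrite exchange_big; apply: eq_bigr => y _ /=.
by rewrite mulmx_suml; apply: eq_bigr => w _; rewrite mulmxA.
Qed.

Lemma fcompDl d g g' f :
  fcomp d (fadd g g') f = fadd (fcomp d g f) (fcomp d g' f).
Proof.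
apply: fam_ext => x z n m; rewrite /fcomp /fadd -big_split /=.
by apply: eq_bigr => y _; rewrite mulmxDr.
Qed.

Lemma fcompDr d g f f' :
  fcomp d g (fadd f f') = fadd (fcomp d g f) (fcomp d g f').
Proof.
apply: fam_ext => x z n m; rewrite /fcomp /fadd -big_split /=.
by apply: eq_bigr => y _; rewrite mulmxDl.
Qed.

Lemma fcompZl d (a : k) g f : fcomp d (fscale a g) f = fscale a (fcomp d g f).
Proof.
apply: fam_ext => x z n m; rewrite /fcomp /fscale scaler_sumr.
by apply: eq_bigr => y _; rewrite scalemxAr.
Qed.

Lemma fcompZr d (a : k) g f : fcomp d g (fscale a f) = fscale a (fcomp d g f).
Proof.
apply: fam_ext => x z n m; rewrite /fcomp /fscale scaler_sumr.
by apply: eq_bigr => y _; rewrite scalemxAl.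
Qed.

Lemma fcomp0l d f : fcomp d (fam0 k) f = fam0 k.
Proof.
by apply: fam_ext => x z n m; apply: big1 => y _; rewrite mulmx0.
Qed.

Lemma fcomp0r d g : fcomp d g (fam0 k) = fam0 k.
Proof.
by apply: fam_ext => x z n m; apply: big1 => y _; rewrite mul0mx.
Qed.

Lemma dEndZ d (a : k) f : dEnd d (fscale a f) = fscale a (dEnd d f).
Proof.
by rewrite /dEnd fcompZl fcompZr fscale_add !fscaleA mulrC.
Qed.

Lemma dEndD d f g : dEnd d (fadd f g) = fadd (dEnd d f) (dEnd d g).
Proof.
rewrite /dEnd fcompDl fcompDr fscale_add.
by apply: fam_ext => *; rewrite /fadd addrACA.
Qed.

Lemma dEnd0 d : dEnd d (fam0 k) = fam0 k.
Proof. by rewrite /dEnd fcomp0l fcomp0r fscale0 fadd0. Qed.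

Lemma dEnd_comp d e g f :
  dEnd (d + e) (fcomp d g f) =
  fadd (fcomp d (dEnd e g) f) (fscale (sgn k e) (fcomp (d + 1) g (dEnd d f))).
Proof.
rewrite /dEnd fcompDl fcompDr fscale_add !fcompZl !fcompZr !fcompA !fscaleA.
rewrite (addrC 1 d); apply: fam_ext => x y n m; rewrite /fadd /fscale.
set A := fcomp _ _ _ _ _ _ _; set B := fcomp _ _ _ _ _ _ _.
set C := fcomp _ _ _ _ _ _ _; rewrite sgnD mulrN (mulrC (sgn k d)) !scaleNr.
by rewrite addrA subrK.
Qed.

(* In the sign conventions of [mu2], [bdiff] is the operation m_1. *)
Definition bdiff (F : int * fam k) : int * fam k :=
  (F.1 + 1, fscale (sgn k F.1) (dEnd F.1 F.2)).

(** The A-infinity relation for two inputs, solved for m_1 of the product; the last sign is minus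
    (-1)^(|F| - 1). *)
Lemma bdiff_mu2 (G F : int * fam k) :
  (bdiff (mu2 G F)).2 =
  fadd (fscale (-1) (mu2 G (bdiff F)).2)
       (fscale (sgn k F.1) (mu2 (bdiff G) F).2).
Proof.
case: G F => [e g] [d f]; rewrite /bdiff /mu2 /=.
rewrite addrC dEndZ dEnd_comp !fcompZl !fcompZr !fscaleA !fscale_add !fscaleA.
rewrite !sgnD sgn1 mulN1r mulrN1 opprK sgnK; apply: fam_ext => x y n m.
rewrite /fadd /fscale [RHS]addrC.
by case: (sgn_pm d) => ->; case: (sgn_pm e) => ->;
  rewrite ?(mul1r, mulN1r, opprK).
Qed.

(** The A-infinity relation for three inputs in a dg category, where m_3 = 0. *)
Lemma mu2A (K G F : int * fam k) :
  (mu2 (mu2 K G) F).2 = fscale (sgn k F.1) (mu2 K (mu2 G F)).2.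
Proof.
rewrite /mu2 /= !fcompZl !fcompZr fcompA !fscaleA sgnD; congr fscale.
  by case: (sgn_pm F.1) => ->; case: (sgn_pm G.1) => ->;
    rewrite ?(mul1r, mulN1r, opprK).
by rewrite addrC.
Qed.

Lemma mu2Zl (a : k) d g (F : int * fam k) :
  (mu2 (d, fscale a g) F).2 = fscale a (mu2 (d, g) F).2.
Proof. by rewrite /mu2 /= fcompZl !fscaleA mulrC. Qed.

Lemma mu2Zr (a : k) d f (G : int * fam k) :
  (mu2 G (d, fscale a f)).2 = fscale a (mu2 G (d, f)).2.
Proof. by rewrite /mu2 /= fcompZr !fscaleA mulrC. Qed.

Definition phom x y (F : int * fam k) := is_hom x y F.1 F.2.

Lemma is_hom0 x y d : is_hom x y d (fam0 k).
Proof. by split=> // n m; split=> v; rewrite mulmx0 mul0mx. Qed.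

Lemma is_homZ x y d (a : k) f : is_hom x y d f -> is_hom x y d (fscale a f).
Proof.
move=> [f0 fm]; split=> [x' y' n m nm|n m].
  by rewrite /fscale f0 ?scaler0.
by have [fi fa] := fm n m; split=> v; rewrite -scalemxAr -scalemxAl ?fi ?fa.
Qed.

Lemma is_homD x y d f g :
  is_hom x y d f -> is_hom x y d g -> is_hom x y d (fadd f g).
Proof.
move=> [f0 fm] [g0 gm]; split=> [x' y' n m nm|n m].
  by rewrite /fadd f0 ?g0 ?addr0.
have [fi fa] := fm n m; have [gi ga] := gm n m.
by split=> v; rewrite /fadd mulmxDr mulmxDl ?fi ?fa ?gi ?ga.
Qed.

Lemma fcomp_homE x y d g f z n m : is_hom x y d f ->
  fcomp d g f x z n m = f x y n (n + d) *m g y z (n + d) m.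
Proof.
move=> [f0 _]; rewrite /fcomp (bigD1 y) //= big1 ?addr0 // => w wy.
by rewrite f0 ?mul0mx // (negbTE wy) andbF.
Qed.

Lemma is_hom_comp x y z d e g f :
  is_hom x y d f -> is_hom y z e g -> is_hom x z (d + e) (fcomp d g f).
Proof.
move=> hf hg; have [f0 fm] := hf; have [g0 gm] := hg.
split=> [x' z' n m nm|n m].
  apply: big1 => w _; case: (boolP [&& x' == x, w == y & n + d == n + d]).
    move=> /and3P[/eqP xx /eqP -> _]; rewrite (g0 y z') ?mulmx0 //.
    by apply: contra nm; rewrite xx !eqxx /= addrA.
  by move=> ?; rewrite f0 ?mul0mx.
rewrite (fcomp_homE _ _ _ _ hf); have [fi fa] := fm n (n + d).
have [gi ga] := gm (n + d) m.
by split=> v; rewrite mulmxA ?fi ?fa -!mulmxA ?gi ?ga.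
Qed.

Lemma phom_mu2 x y z (G F : int * fam k) :
  phom x y F -> phom y z G -> phom x z (mu2 G F).
Proof.
by move=> hF hG; apply: is_homZ; rewrite /= addrC; apply: is_hom_comp hF hG.
Qed.

End DgCategory.

(** * Components of morphisms *)

Section Components.
Variable k : fieldType.
Implicit Types (f g h : fam k) (x y z : obj) (d e n m : int).

Lemma mx_row0 a b (A : 'M[k]_(a, b)) : a = 0%N -> A = 0.
Proof. by move=> a0; subst a; apply/matrixP => -[]. Qed.

Lemma mx_col0 a b (A : 'M[k]_(a, b)) : b = 0%N -> A = 0.
Proof. by move=> b0; subst b; apply/matrixP => ? []. Qed.

Lemma mdimS v n : mdim (mterm k (objS v) n) = if n <= 0 then 2%N else 0%N.
Proof. by rewrite /mterm /=; case: ifP. Qed.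

Lemma mdimP v n : mdim (mterm k (objP v) n) = if n == 0 then 2%N else 0%N.
Proof. by rewrite /mterm /=; case: ifP. Qed.

Lemma mdim_gt0 x n : 0 < n -> mdim (mterm k x n) = 0%N.
Proof.
by case: x => v n0; rewrite ?mdimS ?mdimP ?leNgt ?n0 // gt_eqF.
Qed.

Lemma mdim_le2 x n : (mdim (mterm k x n) <= 2)%N.
Proof. by case: x => v; rewrite ?mdimS ?mdimP; case: ifP. Qed.

(** P_v sits in degree 0, and every summand of M~ is zero in positive degrees. *)
Lemma homP_eq0 v y d f : 0 < d -> is_hom (objP v) y d f -> f = fam0 k.
Proof.
move=> d0 [f0 _]; apply: fam_ext => x' y' n m.
have [/and3P[/eqP-> /eqP-> /eqP->]|/f0 -> //] :=
  boolP [&& x' == objP v, y' == y & m == n + d].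
have [->|n0] := eqVneq n 0; first by apply: mx_col0; rewrite mdim_gt0 ?add0r.
by apply: mx_row0; rewrite mdimP (negbTE n0).
Qed.

(** An endomorphism of P_v is a scalar: the idempotents kill its off-diagonal entries and the arrow
    identifies the two diagonal ones. Composition with a map induced by an arrow keeps this scalar,
    as the entry (0, 1). *)
Lemma modmap_arrow_eq0 (X Y Z : ppmod k) (F : 'M_(mdim X, mdim Y)) v w :
  X = projmod k v -> Y = projmod k v -> Z = projmod k w -> is_modmap F ->
  F *m arrow_mx k (mdim Y) (mdim Z) = 0 -> F = 0.
Proof.
move=> eX eY eZ; subst => -[/= Fi Fa] /matrixP F0.
have F00 : F 0 0 = 0.
  have := F0 0 1; rewrite !mxE !big_ord_recl big_ord0 !mxE /=.
  by rewrite mulr1 mulr0 !addr0.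
have vN : (v == ~~ v) = false by case: (v).
have F01 : F 0 1 = 0.
  have /matrixP/(_ 0 1) := Fi v; rewrite !mxE !big_ord_recl !big_ord0 !mxE /=.
  rewrite addbF eqxx addbT /= mul1r mul0r !addr0 => ->; rewrite mulr0 add0r.
  by rewrite vN mulr0.
have F10 : F 1 0 = 0.
  have /matrixP/(_ 1 0) := Fi v; rewrite !mxE !big_ord_recl !big_ord0 !mxE /=.
  rewrite eqxx addbT addbF eqxx vN !mul0r mulr0 !addr0 mulr1.
  by move=> /esym.
have F11 : F 1 1 = 0.
  have /matrixP/(_ 0 1) := Fa v; rewrite !mxE !big_ord_recl !big_ord0 !mxE /=.
  rewrite eqxx /= mul0r mul1r mulr1 mulr0 !addr0 add0r.
  by rewrite F00 (_ : lift ord0 ord0 = 1) //; apply: val_inj.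
apply/matrixP => i j; rewrite mxE.
have e2 (l : 'I_2) : l = 0 \/ l = 1.
  by case: l => -[|[|//]] ?; [left|right]; apply: val_inj.
by case: (e2 i) => ->; case: (e2 j) => ->.
Qed.

Lemma mterm_S v n : n <= 0 -> mterm k (objS v) n = projmod k (v (+) odd `|n|%N).
Proof. by rewrite /mterm /= => ->. Qed.

Lemma homSS_eq0 v d f : 0 <= d ->
  is_hom (objS v) (objS (v (+) odd `|d|)) d f ->
  dEnd d f = fam0 k ->
  f (objS v) (objS (v (+) odd `|d|)) (- d) 0 = 0 -> f = fam0 k.
Proof.
move=> d0 hf df f0; have [foff fm] := hf; set w := v (+) _ in f0 foff fm hf.
have step (t : nat) :
    f (objS v) (objS w) (- d - t%:Z) (- t%:Z) = 0.
  elim: t => [|t IH]; first by rewrite subr0 oppr0.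
  (* In this component of df the summand in which d comes first contains the preceding component of
     f, which is 0 by induction; what remains is f followed by d. *)
  have /(congr1 (fun F : fam k =>
    F (objS v) (objS w) (- d - t.+1%:Z) (- t%:Z))) := df.
  rewrite /dEnd /fadd /fscale /fam0 (fcomp_homE _ _ _ _ hf) /fcomp.
  rewrite [X in _ *: X]big1 ?scaler0 ?addr0; last first.
    move=> u _; rewrite /diffM; case: eqP => [<-|_]; last by rewrite mul0mx.
    have -> : - d - t.+1%:Z + 1 = - d - t%:Z by lia.
    by rewrite IH mulmx0.
  have -> : - d - t.+1%:Z + d = - t.+1%:Z by lia.
  rewrite /diffM ifT; last by rewrite eqxx; lia.
  apply: (@modmap_arrow_eq0 _ _ _ _ (v (+) odd `|- d - t.+1%:Z|%N)).
  - by rewrite mterm_S //; lia.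
  - rewrite mterm_S; last by lia.
    congr projmod; rewrite /w -addbA -oddD; congr (_ (+) _).
    rewrite (_ : `|- d - t.+1%:Z|%N = (`|d| + `|- t.+1%:Z|)%N) //; lia.
  - by apply: mterm_S; lia.
  exact: fm.
apply: fam_ext => x' y' n m.
have [/and3P[/eqP-> /eqP-> /eqP->]|/foff -> //] :=
  boolP [&& x' == objS v, y' == objS w & m == n + d].
have [nd|nd] := leP (n + d) 0; last by apply: mx_col0; rewrite mdim_gt0.
have [t tE] : exists t : nat, n + d = - t%:Z by exists `|(n + d)%R|%N; lia.
have nE : n = - d - t%:Z by lia.
by rewrite tE nE step.
Qed.

(* Between two Q's, the components of a cycle in the degrees of Ext are scalars,
   each of which determines the next one, starting from Q_(-d) -> Q_0. *)
Lemma hom_ext_eq0 x y d f c : c \in ext_basis x y d ->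
  is_hom x y d f -> (is_inl x && is_inl y -> dEnd d f = fam0 k) ->
  f x y (- d) 0 = 0 -> f = fam0 k.
Proof.
move=> cxy hf df f00; have [f0 _] := hf.
(* If the source or the target is some P, only the component from degree 0 to degree 0 can be
   non-zero. *)
have flat : (forall n, n != 0 -> f x y n n = 0) -> d = 0 -> f = fam0 k.
  move=> fz d0; rewrite d0 ?oppr0 in f0 f00; apply: fam_ext => x' y' n m.
  have [/and3P[/eqP-> /eqP-> /eqP->]|/f0 -> //] :=
    boolP [&& x' == x, y' == y & m == n + 0].
  rewrite addr0; have [->//|/fz] := eqVneq n 0; exact.
case: x y cxy hf df f00 {f0} flat => v [] w; rewrite mem_ext_basis.
- move=> cvw hf df f00 _; have : 0 <= d /\ w = v (+) odd `|d|.
    case/and3P: cvw; case: c => // u r /= /eqP[<-] /eqP[<-] /eqP <-; split=> //.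
      by rewrite absz_nat odd_double addbF.
    by rewrite absz_nat /= odd_double addbT.
  by move=> [d0 ew]; subst w; apply: homSS_eq0 (df isT) f00.
- move=> /and3P[_ ct cd] _ _ _; apply; last first.
    by case: c ct cd => //= u r /eqP.
  by move=> n n0; apply: mx_col0; rewrite mdimP (negbTE n0).
- move=> /and3P[cs ct cd] _ _ _; apply; last first.
    by apply/esym/eqP; case: c cs ct cd.
  by move=> n n0; apply: mx_row0; rewrite mdimP (negbTE n0).
- move=> /and3P[cs ct cd] _ _ _; apply; last first.
    by apply/esym/eqP; case: c cs ct cd.
  by move=> n n0; apply: mx_row0; rewrite mdimP (negbTE n0).
Qed.

(** A family of either shape keeps its shape when an identity-shaped family is composed before it,
    so one boolean suffices for the shape of a product. *)
Definition shape_fam (b : bool) x y d : fam k :=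
  if b then arrow_fam k x y d else id_fam k x y d.

Lemma mul_arrow_mx a b c : arrow_mx k a b *m arrow_mx k b c = 0.
Proof.
apply/matrixP => i j; rewrite !mxE big1 // => l _; rewrite !mxE.
by case: (nat_of_ord l =P 1%N) => [->|_]; rewrite ?andbF ?mul0r ?mulr0.
Qed.

Lemma mul_pid_arrow a b c : (a <= b)%N ->
  pid_mx a *m arrow_mx k b c = arrow_mx k a c.
Proof.
move=> ab; apply/matrixP => i j; rewrite !mxE.
rewrite (bigD1 (widen_ord ab i)) //= big1 => [|l li].
  by rewrite !mxE /= eqxx ltn_ord mul1r addr0.
rewrite !mxE (_ : (i == l :> nat) = false) ?mul0r //.
by apply: contra_neqF li => /eqP il; apply: val_inj.
Qed.

Lemma eqpmP f g x y n m : eqpm f g ->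
  exists s : bool, f x y n m = (-1) ^+ s *: g x y n m.
Proof.
by move=> /(_ x y n m)[->|->]; [exists false|exists true];
  rewrite ?expr0 ?expr1 ?scale1r ?scaleN1r.
Qed.

Lemma eqpmZ (a : k) f g : a = 1 \/ a = -1 -> eqpm f g -> eqpm (fscale a f) g.
Proof.
move=> ha fg x y n m; rewrite /fscale.
by case: ha => ->; case: (fg x y n m) => ->;
  rewrite ?scale1r ?scaleN1r ?opprK; auto.
Qed.

(** The component from degree -(d + e) to degree 0 passes through degree -e of y only; the
    hypothesis on [mdim] says that y is not zero there. *)
Lemma comp_shape b x y z d e g f : is_hom x y d f ->
  eqpm f (id_fam k x y d) -> eqpm g (shape_fam b y z e) ->
  mdim (mterm k y (- e)) = 2%N ->
  exists s : bool, fcomp d g f x z (- (d + e)) 0 =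
    (-1) ^+ s *: shape_fam b x z (d + e) x z (- (d + e)) 0.
Proof.
move=> hf fs gs y2; rewrite (fcomp_homE _ _ _ _ hf).
rewrite (_ : - (d + e) + d = - e); last by lia.
have [s ->] := @eqpmP _ _ x y (- (d + e)) (- e) fs.
have [t ->] := @eqpmP _ _ y z (- e) 0 gs.
exists (s (+) t); rewrite -scalemxAl -scalemxAr scalerA signr_addb.
congr (_ *: _); case: b {gs}; rewrite /shape_fam /arrow_fam /id_fam !eqxx /=.
  rewrite !ifT; try lia.
  by apply: mul_pid_arrow; rewrite y2 mdim_le2.
rewrite !ifT; try lia.
rewrite mul_pid_mx y2 (minn_idPr (geq_minr _ _)) (minn_idPl _) //.
exact: mdim_le2.
Qed.

End Components.

(** * Words *)

(* r composable arrows in composition order, the first of which ends at P_v;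
   the last one begins at P_(v + r). *)
Fixpoint arrs (v : vertex) (r : nat) : seq basis :=
  if r is r'.+1 then Ba (~~ v) :: arrs (~~ v) r' else [::].

(* The basis element of degree d of Ext^*(S_v, S_(v + d)). *)
Definition sx (v : vertex) (d : nat) : basis :=
  if odd d then Bx v d./2 else Bu v d./2.

Definition is_ext (b : basis) : bool :=
  match b with Bu _ _ | Bx _ _ => true | _ => false end.

Definition arrow_like (b : basis) : bool :=
  match b with Ba _ | Bj _ => true | _ => false end.

Lemma sx_surj b : is_ext b -> exists v d, b = sx v d.
Proof.
case: b => // v n _; exists v; [exists n.*2|exists n.*2.+1].
  by rewrite /sx odd_double doubleK.
by rewrite /sx /= odd_double uphalf_double.
Qed.

Lemma is_ext_sx v d : is_ext (sx v d).
Proof. by rewrite /sx; case: ifP. Qed.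

Lemma src_sx v d : src (sx v d) = objS v.
Proof. by rewrite /sx; case: ifP. Qed.

Lemma tgt_sx v d : tgt (sx v d) = objS (v (+) odd d).
Proof. by rewrite /sx; case: ifP => _ /=; rewrite ?addbF ?addbT. Qed.

Lemma deg_sx v d : deg (sx v d) = d%:Z.
Proof. by rewrite /sx; case: ifP => od /=; congr Posz; lia. Qed.

Lemma arrs_cat v r s : arrs v (r + s) = arrs v r ++ arrs (v (+) odd r) s.
Proof.
elim: r v => [|r IH] v /=; first by rewrite addbF.
by rewrite IH addbN addNb.
Qed.

Lemma arrsSr v r : arrs v r.+1 = rcons (arrs v r) (Ba (v (+) odd r.+1)).
Proof. by rewrite -[in LHS]addn1 arrs_cat cats1 /= addbN. Qed.

Lemma size_arrs v r : size (arrs v r) = r.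
Proof. by elim: r v => //= r IH v; rewrite IH. Qed.

Lemma arrs_not_ext v r : has is_ext (arrs v r) = false.
Proof. by elim: r v => //= r IH v; rewrite IH. Qed.

(** Here and in the next two definitions the h-maps are indexed by the absolute value d of their
    degree, so that one formula covers equal vertices (d even) and opposite ones (d odd). *)
Definition hSP v d := if odd d then hSvPw v d./2 else hSvPv v d./2.
Definition hSS v d := if odd d then hSvSw v d./2 else hSvSv v d./2.
Definition hPS v d := if odd d then hPwSv v d./2 else hPvSv v d./2.

Lemma hSPE v d : [/\ hsrc (hSP v d) = objP (v (+) odd d),
  htgt (hSP v d) = objS v & hdeg (hSP v d) = - d%:Z].
Proof.
by rewrite /hSP; case: ifP => od; split; rewrite /= ?addbT ?addbF //; lia.
Qed.

Lemma hSSE v d : [/\ hsrc (hSS v d) = objS (v (+) odd d),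
  htgt (hSS v d) = objS v & hdeg (hSS v d) = - d%:Z].
Proof.
by rewrite /hSS; case: ifP => od; split; rewrite /= ?addbT ?addbF //; lia.
Qed.

Lemma hPSE v d : [/\ hsrc (hPS v d) = objS v,
  htgt (hPS v d) = objP (v (+) odd d) & hdeg (hPS v d) = d%:Z].
Proof.
by rewrite /hPS; case: ifP => od; split; rewrite /= ?addbT ?addbF //; lia.
Qed.

(* Below the root, only these inputs have a tree with a non-zero value: a
   single basis element, the words p a ... a and p a ... a j (by the left comb)
   and the words a ... a j x with x in Ext^*(S, S) (by the right comb). *)
Inductive lword : seq basis -> hindex -> Prop :=
| lword_a v r : lword (Bp v :: arrs v r.+1) (hSP v r.+1)
| lword_j v r :
    lword (Bp v :: rcons (arrs v r) (Bj (v (+) odd r))) (hSS v r.+1).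

(** Each of the r + 1 letters before x brings one H, which lowers the degree by one: x has degree d
    + r + 1 so that the value has degree d. *)
Inductive rword : seq basis -> hindex -> Prop :=
| rword_jx v r d :
    rword (arrs v r ++ [:: Bj (v (+) odd r); sx (v (+) odd d) (d + r).+1])
          (hPS (v (+) odd d) d).

Definition hword bs h := lword bs h \/ rword bs h.

Definition admissible bs := (exists b, bs = [:: b]) \/ (exists h, hword bs h).

(** The default letter [oneP1] is reached only by the empty word. *)
Definition bsrc (bs : seq basis) : obj := src (last oneP1 bs).
Definition btgt (bs : seq basis) : obj := tgt (head oneP1 bs).

Lemma composable_cat b c : b != [::] -> c != [::] ->
  composable (b ++ c) = [&& composable b, composable c & bsrc b == btgt c].
Proof.
case: b c => [|b bs] [|c cs] // _ _.
by rewrite /composable /sorted /= cat_path /=; congr (_ && _); rewrite andbC.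
Qed.

Lemma composable_arrs v r : composable (arrs v r).
Proof.
elim: r v => // -[|r] IH v //; rewrite /= in IH *.
by rewrite negbK eqxx; apply: IH.
Qed.

Lemma bsrc_cat b c : c != [::] -> bsrc (b ++ c) = bsrc c.
Proof. by case: c => // c cs _; rewrite /bsrc last_cat. Qed.

Lemma btgt_cat b c : b != [::] -> btgt (b ++ c) = btgt b.
Proof. by case: b. Qed.

Lemma bsrc_arrs v r : bsrc (arrs v r.+1) = objP (v (+) odd r.+1).
Proof. by rewrite arrsSr /bsrc last_rcons. Qed.

Lemma bsrc_parrs v r : bsrc (Bp v :: arrs v r) = objP (v (+) odd r).
Proof. by case: r => [|r]; rewrite ?bsrc_arrs /bsrc /= ?addbF //=;
  have := bsrc_arrs v r. Qed.

Lemma composable_parrs v r : composable (Bp v :: arrs v r).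
Proof.
case: r => // r; rewrite -cat1s composable_cat // composable_arrs /=.
by rewrite /bsrc /btgt /= negbK eqxx.
Qed.

Lemma lwordP bs h : lword bs h ->
  [/\ composable bs, bsrc bs = hsrc h, btgt bs = htgt h & ~~ has is_ext bs].
Proof.
case=> v r.
  have [-> -> _] := hSPE v r.+1.
  by rewrite composable_parrs bsrc_parrs /= arrs_not_ext.
have [-> -> _] := hSSE v r.+1; rewrite -cats1 -cat_cons composable_cat //.
rewrite composable_parrs bsrc_parrs bsrc_cat // has_cat /= arrs_not_ext.
by rewrite /bsrc /= addbN eqxx.
Qed.

Lemma rwordP bs h : rword bs h ->
  [/\ composable bs, bsrc bs = hsrc h, btgt bs = htgt h &
      exists2 bs', bs = rcons bs' (last oneP1 bs) &
        is_ext (last oneP1 bs) && ~~ has is_ext bs'].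
Proof.
case=> v r d; have [-> -> _] := hPSE (v (+) odd d) d.
rewrite -addbA addbb addbF bsrc_cat // /bsrc /= src_sx; split=> //.
- case: r => [|r]; first by rewrite /= tgt_sx /= addn0 /= -addbA addbN addbb
    addbT addbF eqxx.
  rewrite composable_cat // composable_arrs bsrc_arrs /= tgt_sx /=.
  rewrite -addbA (_ : odd d (+) _ = odd r); last by lia.
  by rewrite addbN negbK !eqxx.
- by case: r => [|r] /=; rewrite /btgt /= ?addbF ?negbK.
exists (rcons (arrs v r) (Bj (v (+) odd r))).
  by rewrite last_cat /= -!cats1 -catA.
by rewrite last_cat /= is_ext_sx has_rcons /= arrs_not_ext.
Qed.

(** * Combs *)

Fixpoint lcomb (n : nat) : tree :=
  if n is (_.+1 as m).+1 then Node (lcomb m) Leaf else Leaf.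

Fixpoint rcomb (n : nat) : tree :=
  if n is (_.+1 as m).+1 then Node Leaf (rcomb m) else Leaf.

(** The last letter tells the two kinds of words apart: it lies in Ext^*(S, S) for an [rword] and
    does not for an [lword]. For a single letter both combs are [Leaf]. *)
Definition comb (bs : seq basis) : tree :=
  (if is_ext (last oneP1 bs) then rcomb else lcomb) (size bs).

Lemma leaves_lcomb n : leaves (lcomb n.+1) = n.+1.
Proof. by elim: n => //= n ->; rewrite addn1. Qed.

Lemma leaves_rcomb n : leaves (rcomb n.+1) = n.+1.
Proof. by elim: n => //= n ->. Qed.

Lemma leaves_comb bs : bs != [::] -> leaves (comb bs) = size bs.
Proof.
by case: bs => // b bs _; rewrite /comb; case: ifP => _;
  rewrite ?leaves_lcomb ?leaves_rcomb.
Qed.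

Lemma comb1 b : comb [:: b] = Leaf.
Proof. by rewrite /comb; case: ifP. Qed.

Lemma comb_rcons bs e : bs != [::] -> ~~ is_ext (last oneP1 bs) ->
  ~~ is_ext e -> comb (rcons bs e) = Node (comb bs) Leaf.
Proof.
move=> bs0 bse ee; rewrite /comb last_rcons (negbTE ee) (negbTE bse).
by rewrite size_rcons; case: bs bs0 {bse}.
Qed.

Lemma comb_cons bs g : bs != [::] -> is_ext (last oneP1 bs) ->
  comb (g :: bs) = Node Leaf (comb bs).
Proof. by case: bs => // b bs _ bse; rewrite /comb /= bse. Qed.

Lemma last_lword bs h : lword bs h -> is_ext (last oneP1 bs) = false.
Proof.
case=> v r; last by rewrite /= last_rcons.
by rewrite last_cons arrsSr last_rcons.
Qed.

Lemma last_rword bs h : rword bs h -> is_ext (last oneP1 bs).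
Proof. by case=> v r d; rewrite last_cat /= is_ext_sx. Qed.

Lemma hword_size bs h : hword bs h -> (1 < size bs)%N.
Proof.
by case=> -[] v r *; rewrite /= ?size_rcons ?size_cat //= addn2.
Qed.

Lemma hword_neq0 bs h : hword bs h -> bs != [::].
Proof. by move/hword_size; case: bs. Qed.

Lemma hwordP bs h : hword bs h ->
  [/\ composable bs, bsrc bs = hsrc h & btgt bs = htgt h].
Proof. by case=> [/lwordP|/rwordP] []. Qed.

(** The degree index r + 1 of an [lword] is positive, so if it is even the exponent n is at least
    1. *)
Lemma h_occurs_hword bs h : hword bs h -> h_occurs h.
Proof.
by case=> -[] v r *; rewrite /h_occurs /hSP /hSS /hPS;
  case: ifP => // od; case: half (odd_double_half r.+1) => //; rewrite od.
Qed.

(** * The list of operations *)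

(* [op_list] and its image under kappa, uniformly in the parities. *)
Inductive gen_op : seq basis -> basis -> Prop :=
| gen_op_jp v : gen_op [:: Bj v; Bp (~~ v)] (Ba (~~ v))
| gen_op_ss v d e : gen_op [:: sx (v (+) odd d) e; sx v d] (sx v (e + d))
| gen_op_sp v r : gen_op (sx v r :: Bp v :: arrs v r) (Bp (v (+) odd r))
| gen_op_spj v r d :
    gen_op (sx v (d + r).+1 :: Bp v :: rcons (arrs v r) (Bj (v (+) odd r)))
        (sx (~~ (v (+) odd r)) d)
| gen_op_pjs v r d :
    gen_op (Bp v :: arrs v r ++
           [:: Bj (v (+) odd r); sx (v (+) odd d) (d + r).+1])
        (sx (v (+) odd d) d)
| gen_op_ajs v r :
    gen_op (arrs v r.+1 ++ [:: Bj (v (+) odd r.+1); sx (~~ v) r.+1]) (Bj v)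
| gen_op_ajsp v r s :
    gen_op (arrs v r ++ [:: Bj (v (+) odd r); sx (v (+) odd s) (s + r).+1] ++
           Bp (v (+) odd s) :: arrs (v (+) odd s) s) (B1 v).

Lemma kappaK : involutive kappa.
Proof. by case=> *; rewrite /= negbK. Qed.

Lemma kappa_sx v d : kappa (sx v d) = sx (~~ v) d.
Proof. by rewrite /sx; case: ifP. Qed.

Lemma kappa_arrs v r : [seq kappa b | b <- arrs v r] = arrs (~~ v) r.
Proof. by elim: r v => //= r IH v; rewrite IH. Qed.

Definition kappaE := (map_cat, map_rcons, kappa_arrs, kappa_sx).

Lemma gen_op_eq bs c bs' c' : gen_op bs c -> bs = bs' -> c = c' ->
  gen_op bs' c'.
Proof. by move=> ? <- <-. Qed.

Lemma gen_op_kappa bs c : gen_op bs c ->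
  gen_op [seq kappa b | b <- bs] (kappa c).
Proof.
case=> [v|v d e|v r|v r d|v r d|v r|v r s]; rewrite /= ?kappaE /= ?kappaE.
- exact: gen_op_jp.
- by apply: gen_op_eq (gen_op_ss (~~ v) d e) _ _; rewrite ?addNb.
- by apply: gen_op_eq (gen_op_sp (~~ v) r) _ _; rewrite ?addNb.
- by apply: gen_op_eq (gen_op_spj (~~ v) r d) _ _; rewrite ?addNb.
- by apply: gen_op_eq (gen_op_pjs (~~ v) r d) _ _; rewrite ?addNb.
- by apply: gen_op_eq (gen_op_ajs (~~ v) r) _ _; rewrite /= ?addNb.
- by apply: gen_op_eq (gen_op_ajsp (~~ v) r s) _ _; rewrite ?addNb.
Qed.

Lemma s212E n : s212 n = arrs v1 n.*2.
Proof. by elim: n => // n IH; rewrite doubleS [RHS]/= -IH. Qed.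

Lemma s121E n : s121 n = arrs v2 n.*2.
Proof. by elim: n => // n IH; rewrite doubleS [RHS]/= -IH. Qed.

Lemma sx_even v n : sx v n.*2 = Bu v n.
Proof. by rewrite /sx odd_double doubleK. Qed.

Lemma sx_odd v n : sx v n.*2.+1 = Bx v n.
Proof. by rewrite /sx /= odd_double uphalf_double. Qed.

Lemma arrs_oddr v n : arrs v n.*2 ++ [:: Ba (~~ v)] = arrs v n.*2.+1.
Proof. by rewrite cats1 arrsSr /= odd_double addbT. Qed.

(** A block of n pairs of arrows has length 2n, and the powers u^n and beta u^n have degrees 2n and
    2n + 1; each formula is thus one of the seven families with the parities of its parameters
    fixed. *)
Lemma gen_op_of_op_list bs c : op_list bs c -> gen_op bs c.
Proof.
pose E := (odd_double, addbT, addbF).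
case=> {bs c} [|n m|m n|m n|m n|n q|n|n q qn|n q qn|n q qn|n q qn|n q qn|n q qn
  |n|n|n q|n|n q qn|m n mn|m n mn|m n mn];
  rewrite ?s212E ?s121E.
- exact: (gen_op_jp v1).
- apply: (gen_op_eq (gen_op_ss v1 m.*2 n.*2)); first by rewrite !sx_even !E.
  by rewrite -doubleD sx_even.
- apply: (gen_op_eq (gen_op_ss v1 n.*2 m.*2.+1)).
    by rewrite sx_even sx_odd !E.
  by rewrite (_ : (_ + _)%N = (n + m).*2.+1) ?sx_odd //; lia.
- apply: (gen_op_eq (gen_op_ss v1 n.*2.+1 m.*2)).
    by rewrite sx_even sx_odd /= !E.
  by rewrite (_ : (_ + _)%N = (n + m).*2.+1) ?sx_odd //; lia.
- apply: (gen_op_eq (gen_op_ss v1 n.*2.+1 m.*2.+1)).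
    by rewrite !sx_odd /= !E.
  by rewrite (_ : (_ + _)%N = (n + m).+1.*2) ?sx_even //; lia.
- apply: (gen_op_eq (gen_op_ajsp v2 q.*2.+1 n.*2.+1)) => //.
  rewrite (_ : (_ + _).+1%N = (n + q).+1.*2.+1) ?sx_odd; last lia.
  by rewrite (arrs_oddr v1) /= !E.
- apply: (gen_op_eq (gen_op_ajs v2 n.*2)) => //.
  by rewrite sx_odd /= !E.
- apply: (gen_op_eq (gen_op_ajsp v1 q.*2 (n - q).*2)) => //.
  rewrite (_ : (_ + _).+1%N = n.*2.+1) ?sx_odd; last lia.
  by rewrite !E.
- apply: (gen_op_eq (gen_op_spj v1 n.*2 (q - n - 1).*2.+1)).
    rewrite (_ : (_ + _).+1%N = q.*2) ?sx_even; last lia.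
    by rewrite !E /= cats1.
  by rewrite sx_odd !E.
- apply: (gen_op_eq (gen_op_spj v1 n.*2 (q - n).*2)).
    rewrite (_ : (_ + _).+1%N = q.*2.+1) ?sx_odd; last lia.
    by rewrite !E /= cats1.
  by rewrite sx_even !E.
- apply: (gen_op_eq (gen_op_spj v1 n.*2.+1 (q - n - 1).*2)).
    rewrite (_ : (_ + _).+1%N = q.*2) ?sx_even; last lia.
    by rewrite -(arrs_oddr v1) -cats1 -catA /= !E.
  by rewrite sx_even /= !E.
- apply: (gen_op_eq (gen_op_pjs v1 n.*2.+1 (q - n - 1).*2)).
    rewrite (_ : (_ + _).+1%N = q.*2) ?sx_even; last lia.
    by rewrite -(arrs_oddr v1) -catA /= !E.
  by rewrite sx_even /= !E.
- apply: (gen_op_eq (gen_op_spj v1 n.*2.+1 (q - n - 1).*2.+1)).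
    rewrite (_ : (_ + _).+1%N = q.*2.+1) ?sx_odd; last lia.
    by rewrite -(arrs_oddr v1) -cats1 -catA /= !E.
  by rewrite sx_odd /= !E.
- apply: (gen_op_eq (gen_op_sp v1 n.*2.+1)); last by rewrite /= !E.
  by rewrite sx_odd -(arrs_oddr v1).
- apply: (gen_op_eq (gen_op_sp v1 n.*2)); last by rewrite /= !E.
  by rewrite sx_even.
- apply: (gen_op_eq (gen_op_ajsp v2 q.*2 n.*2.+1)) => //.
  rewrite (_ : (_ + _).+1%N = (n + q).+1.*2) ?sx_even; last lia.
  by rewrite (arrs_oddr v1) /= !E.
- apply: (gen_op_eq (gen_op_ajs v2 n.*2.+1)) => //.
  by rewrite (sx_even _ n.+1) /= !E.
- apply: (gen_op_eq (gen_op_ajsp v1 q.*2.+1 (n - q).*2)) => //.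
  rewrite (_ : (_ + _).+1%N = n.+1.*2) ?sx_even; last lia.
  by rewrite -(arrs_oddr v1) -catA /= !E.
- apply: (gen_op_eq (gen_op_pjs v2 m.*2 (n - m).*2)).
    rewrite (_ : (_ + _).+1%N = n.*2.+1) ?sx_odd; last lia.
    by rewrite /= !E.
  by rewrite sx_even /= !E.
- apply: (gen_op_eq (gen_op_pjs v2 m.*2 (n - (m + 1)).*2.+1)).
    rewrite (_ : (_ + _).+1%N = n.*2) ?sx_even; last lia.
    by rewrite /= !E.
  by rewrite sx_odd /= !E.
- apply: (gen_op_eq (gen_op_pjs v1 m.*2.+1 (n - m).*2.+1)).
    rewrite (_ : (_ + _).+1%N = n.+1.*2.+1) ?sx_odd; last lia.
    by rewrite /= !E.
  by rewrite sx_odd /= !E.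
Qed.

Lemma gen_op_of_in_list bs c : in_list bs c -> gen_op bs c.
Proof.
case=> [/gen_op_of_op_list //|/gen_op_of_op_list/gen_op_kappa].
by rewrite kappaK (mapK kappaK).
Qed.

Lemma parity_cases r : (exists n, r = n.*2) \/ (exists n, r = n.*2.+1).
Proof.
by case: (boolP (odd r)) => ?; [right|left]; exists r./2; lia.
Qed.

Lemma vertex_cases (a v : vertex) : v = a \/ v = ~~ a.
Proof. by case: a v => [] []; auto. Qed.

Lemma in_list_kappa bs c :
  in_list [seq kappa b | b <- bs] (kappa c) -> in_list bs c.
Proof. by case; [right|rewrite kappaK (mapK kappaK); left]. Qed.

(** The parities of the parameters select the formula: the families split into 1 + 4 + 2 + 4 + 4 + 2
    + 4 = 21 cases, which are exactly the constructors of [op_list]. *)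
Lemma in_list_of_gen_op bs c : gen_op bs c -> in_list bs c.
Proof.
have T bs0 c0 bs1 c1 : op_list bs0 c0 -> bs0 = bs1 -> c0 = c1 -> in_list bs1 c1.
  by move=> ? <- <-; left.
pose E := (odd_double, addbT, addbF).
(* Up to kappa, it suffices to treat the orientation of the given list. *)
have K (w : vertex -> seq basis * basis) (a v : vertex) :
    (forall v, [seq kappa b | b <- (w v).1] = (w (~~ v)).1) ->
    (forall v, kappa (w v).2 = (w (~~ v)).2) ->
    in_list (w a).1 (w a).2 -> in_list (w v).1 (w v).2.
  move=> k1 k2 la; have [->//|->] := vertex_cases a v.
  by apply: in_list_kappa; rewrite k1 k2 negbK.
case=> {bs c} [v|v d e|v r|v r d|v r d|v r|v r s].
- apply: (K (fun v => ([:: Bj v; Bp (~~ v)], Ba (~~ v))) v1) => //.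
  exact: T op2_jp _ _.
- apply: (K (fun v => ([:: sx (v (+) odd d) e; sx v d], sx v (e + d))) v1).
  + by move=> w; rewrite /= !kappa_sx addNb.
  + by move=> w; rewrite /= kappa_sx.
  have [[m ->]|[m ->]] := parity_cases d;
    have [[n ->]|[n ->]] := parity_cases e;
    rewrite /= ?sx_even ?sx_odd ?E.
  + apply: T (op2_uu n m) _ _ => //; rewrite /u1 -sx_even; congr sx; lia.
  + apply: T (op2_bu n m) _ _ => //; rewrite /beta_u -sx_odd; congr sx; lia.
  + apply: T (op2_ub n m) _ _ => //; rewrite /beta_u -sx_odd; congr sx; lia.
  + apply: T (op2_ab n m) _ _ => //; rewrite /u1 -sx_even; congr sx; lia.
- apply: (K (fun v => (sx v r :: Bp v :: arrs v r, Bp (v (+) odd r))) v1).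
  + by move=> w; rewrite /= kappa_sx kappa_arrs.
  + by move=> w; rewrite /= addNb.
  have [[n ->]|[n ->]] := parity_cases r;
    rewrite [_.1]/= [_.2]/= ?sx_even ?sx_odd.
  + by apply: T (op_10 n) _ _; rewrite ?s212E ?E.
  + by apply: T (op_9 n) _ _; rewrite ?s212E ?(arrs_oddr v1) /= ?E.
- apply: (K (fun v => (sx v (d + r).+1 :: Bp v ::
    rcons (arrs v r) (Bj (v (+) odd r)), sx (~~ (v (+) odd r)) d)) v1).
  + by move=> w; rewrite /= !kappaE /= addNb.
  + by move=> w; rewrite /= kappa_sx addNb.
  have [[m ->]|[m ->]] := parity_cases d;
    have [[n ->]|[n ->]] := parity_cases r.
  + apply: T (@op_5 n (m + n) _) _ _; rewrite ?leq_addl //.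
      rewrite s212E /= ?E (_ : (_ + _).+1%N = (m + n).*2.+1) ?sx_odd ?cats1 //;
        lia.
    by rewrite /= !E sx_even addnK.
  + apply: T (@op_6 n (m + n + 1) _) _ _; rewrite ?leq_add2r ?leq_addl //.
      rewrite s212E -cats1 -(arrs_oddr v1) -catA /= ?E.
      by rewrite (_ : (_ + _).+1%N = (m + n + 1).*2) ?sx_even //; lia.
    by rewrite /= !E sx_even; congr Bu; lia.
  + apply: T (@op_4 n (m + n + 1) _) _ _; rewrite ?leq_add2r ?leq_addl //.
      by rewrite s212E /= ?E (_ : (_ + _).+1%N =
        (m + n + 1).*2) ?sx_even ?cats1 //; lia.
    by rewrite /= !E sx_odd; congr Bx; lia.
  + apply: T (@op_8 n (m + n + 1) _) _ _; rewrite ?leq_add2r ?leq_addl //.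
      rewrite s212E -cats1 -(arrs_oddr v1) -catA /= ?E.
      by rewrite (_ : (_ + _).+1%N = (m + n + 1).*2.+1) ?sx_odd //; lia.
    by rewrite /= !E sx_odd; congr Bx; lia.
(* The vertex [odd r] turns the letter j of the word into j_2, as in the four formulas of the
   list. *)
- apply: (K (fun v => (Bp v :: arrs v r ++
           [:: Bj (v (+) odd r); sx (v (+) odd d) (d + r).+1],
        sx (v (+) odd d) d)) (odd r)).
  + by move=> w; rewrite /= !kappaE /= !addNb kappa_sx.
  + by move=> w; rewrite /= kappa_sx addNb.
  have [[m ->]|[m ->]] := parity_cases d;
    have [[n ->]|[n ->]] := parity_cases r;
    rewrite ?[odd _.+1]/= !odd_double.
  + apply: T (@op_14 n (m + n) _) _ _; rewrite ?leq_addl //.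
      by rewrite s121E /= (_ : (_ + _).+1%N = (m + n).*2.+1) ?sx_odd //; lia.
    by rewrite /= sx_even addnK.
  + apply: T (@op_7 n (m + n + 1) _) _ _; rewrite ?leq_add2r ?leq_addl //.
      rewrite s212E -(arrs_oddr v1) -catA /=.
      by rewrite (_ : (_ + _).+1%N = (m + n + 1).*2) ?sx_even //; lia.
    by rewrite /= sx_even; congr Bu; lia.
  + apply: T (@op_15 n (m + n + 1) _) _ _; first lia.
      by rewrite s121E /= (_ : (_ + _).+1%N = (m + n + 1).*2) ?sx_even //; lia.
    by rewrite /= sx_odd; congr Bx; lia.
  + apply: T (@op_16 n (m + n) _) _ _; rewrite ?leq_addl //.
      by rewrite s121E /= (_ : (_.+1 + _).+1%N = (m + n).+1.*2.+1) ?sx_odd //;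
        lia.
    by rewrite /= sx_odd addnK.
- apply: (K (fun v => (arrs v r.+1 ++ [:: Bj (v (+) odd r.+1); sx (~~ v) r.+1],
    Bj v)) v2) => //.
  + by move=> w; rewrite /= !kappaE /= !addNb kappa_sx.
  have [[n ->]|[n ->]] := parity_cases r.
  + apply: T (op_2 n) _ _ => //.
    by rewrite s212E sx_odd /= !E.
  + apply: T (op_12 n) _ _ => //.
    by rewrite s121E (sx_even _ n.+1) /= !E.
(* The vertex [~~ odd s] turns the letter p of the word into p_1, as in the four formulas of the
   list. *)
- apply: (K (fun v => (arrs v r ++
    [:: Bj (v (+) odd r); sx (v (+) odd s) (s + r).+1] ++
           Bp (v (+) odd s) :: arrs (v (+) odd s) s, B1 v)) (~~ odd s)) => //.
  + by move=> w; rewrite /= !kappaE /= !addNb kappa_sx kappa_arrs.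
  have [[m ->]|[m ->]] := parity_cases s;
    have [[n ->]|[n ->]] := parity_cases r;
    rewrite ?[odd _.+1]/= !odd_double.
  + apply: T (@op_3 (m + n) n _) _ _; rewrite ?leq_addl //.
    rewrite !s212E addnK /=.
    by rewrite (_ : (_ + _).+1%N = (m + n).*2.+1) ?sx_odd //; lia.
  + apply: T (@op_13 (m + n) n _) _ _; rewrite ?leq_addl //.
    rewrite !s212E addnK -(arrs_oddr v1) -catA /=.
    by rewrite (_ : (_.*2 + _).+1%N = (m + n).+1.*2) ?sx_even //; lia.
  + apply: T (op_11 m n) _ _ => //.
    rewrite s212E s121E (arrs_oddr v1) /=.
    by rewrite (_ : (_.+1 + _).+1%N = (m + n).+1.*2) ?sx_even //; lia.
  + apply: T (op_1 m n) _ _ => //.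
    rewrite !s212E (arrs_oddr v1) /=.
    by rewrite (_ : (_.+1 + _).+1%N = (m + n).+1.*2.+1) ?sx_odd //; lia.
Qed.

(** * Auxiliary facts on sums, products of arrows, cut words and Ext groups *)

Lemma sum_seq1 (V : nmodType) (T : eqType) (r : seq T) (j : T) (F : T -> V) :
  j \in r -> uniq r -> (forall x, x \in r -> x != j -> F x = 0) ->
  \sum_(x <- r) F x = F j.
Proof.
move=> jr ur F0; rewrite (bigD1_seq j) //= big_seq_cond big1 ?addr0 //.
by move=> x /andP[]; apply: F0.
Qed.

Definition pscale (k : fieldType) (a : k) (F : int * fam k) : int * fam k :=
  (F.1, fscale a F.2).

Lemma bdiff_eq0 (k : fieldType) (F : int * fam k) :
  ((bdiff F).2 = fam0 k) <-> (dEnd F.1 F.2 = fam0 k).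
Proof.
rewrite /bdiff /=; split=> [|->]; last exact: fscale0.
by move=> /(congr1 (fscale (sgn k F.1))); rewrite fscaleA sgnK fscale1 fscale0.
Qed.

Lemma mu2_0l (k : fieldType) (G F : int * fam k) :
  G.2 = fam0 k -> (mu2 G F).2 = fam0 k.
Proof. by rewrite /mu2 /= => ->; rewrite fcomp0l fscale0. Qed.

Lemma mu2_0r (k : fieldType) (G F : int * fam k) :
  F.2 = fam0 k -> (mu2 G F).2 = fam0 k.
Proof. by rewrite /mu2 /= => ->; rewrite fcomp0r fscale0. Qed.

Lemma arrow_comp0 (k : fieldType) x y d x' y' d' e (g f : fam k) :
  eqpm g (arrow_fam k x y d) -> eqpm f (arrow_fam k x' y' d') ->
  fcomp e g f = fam0 k.
Proof.
move=> ag af; apply: fam_ext => u w n m; apply: big1 => z _.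
have arr (h : fam k) a b c s t q1 q2 : eqpm h (arrow_fam k a b c) ->
    exists l : k, h s t q1 q2 = l *: arrow_mx k _ _.
  move=> /(_ s t q1 q2); rewrite /arrow_fam; case: ifP => _.
    by case=> ->; [exists 1; rewrite scale1r|exists (-1); rewrite scaleN1r].
  by case=> ->; exists 0; rewrite scale0r ?oppr0.
have [l ->] := arr _ _ _ _ u z n (n + e) af.
have [l' ->] := arr _ _ _ _ z w (n + e) m ag.
by rewrite -scalemxAl -scalemxAr mul_arrow_mx !scaler0.
Qed.

Lemma deg_ge0 b : 0 <= deg b.
Proof. by case: b. Qed.

Lemma ext_nil x y d :
  (forall c, src c = x -> tgt c = y -> deg c = d -> False) ->
  ext_basis x y d = [::].
Proof.
move=> nc; case E : (ext_basis x y d) => [//|c l].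
have := mem_head c l; rewrite -E mem_ext_basis => /and3P[/eqP s /eqP t /eqP e].
by case: (nc c s t e).
Qed.

Lemma cycle_shapeE (k : fieldType) b :
  cycle_shape k b = shape_fam k (arrow_like b) (src b) (tgt b) (deg b).
Proof. by case: b. Qed.

Lemma arrow_like_sx v d : arrow_like (sx v d) = false.
Proof. by rewrite /sx; case: ifP. Qed.

Lemma hasN_take (T : eqType) (a : pred T) n s : ~~ has a s ->
  ~~ has a (take n s).
Proof.
by apply: contra => /hasP[x /mem_take xs ax]; apply/hasP; exists x.
Qed.

Lemma hasN_last (T : eqType) (a : pred T) x s : s != [::] -> ~~ has a s ->
  ~~ a (last x s).
Proof. by case/lastP: s => // s y _;
  rewrite has_rcons last_rcons negb_or => /andP[]. Qed.

(** With [pjs_drop]: wherever p a ... a j x is cut, both parts are admissible. Only the cuts after p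
    and before x leave a single letter. *)
Lemma pjs_take v r (d s : nat) : (s <= r)%N ->
  exists h, lword (take s.+2 (Bp v :: arrs v r ++
    [:: Bj (v (+) odd r); sx (v (+) odd d) (d + r).+1])) h.
Proof.
move=> sr; rewrite [take _ _]/= -cat_rcons.
have [->|sr'] := eqVneq s r.
  rewrite take_size_cat ?size_rcons ?size_arrs //.
  by exists (hSS v r.+1); apply: lword_j.
have lsr : (s < r)%N by rewrite ltn_neqAle sr' sr.
rewrite cat_rcons takel_cat ?size_arrs //.
rewrite -[in arrs v r](subnKC lsr) arrs_cat take_size_cat ?size_arrs //.
by exists (hSP v s.+1); apply: lword_a.
Qed.

(** The degree d + s of the value grows with the number of letters cut off; this singles out the
    first splitting in [m_op_pjs]. *)
Lemma pjs_drop v r (d s : nat) : (s <= r)%N ->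
  rword (drop s.+1 (Bp v :: arrs v r ++
    [:: Bj (v (+) odd r); sx (v (+) odd d) (d + r).+1]))
    (hPS (v (+) odd d) (d + s)).
Proof.
move=> sr; rewrite [drop _ _]/= drop_cat size_arrs.
have vr : v (+) odd r = v (+) odd s (+) odd (r - s).
  by rewrite -addbA -oddD subnKC.
have vd : v (+) odd d = v (+) odd s (+) odd (d + s).
  by rewrite oddD [odd d (+) _]addbC addbA -[v (+) _ (+) _]addbA addbb addbF.
have dr : (d + r).+1 = (d + s + (r - s)).+1 by rewrite -addnA subnKC.
have := rword_jx (v (+) odd s) (r - s) (d + s).
rewrite -vr -vd -dr; congr rword.
case: ltnP => [sr'|rs].
  by rewrite -[in drop _ _](subnKC sr) arrs_cat drop_size_cat ?size_arrs.
have -> : s = r by apply/eqP; rewrite eqn_leq sr.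
by rewrite subnn drop0.
Qed.

Lemma ext_SS c a b : src c = objS a -> tgt c = objS b ->
  exists2 n, deg c = n%:Z & b = a (+) odd n.
Proof.
case: c => // v n [<-] [<-]; first by exists n.*2; rewrite ?odd_double ?addbF.
by exists n.*2.+1; rewrite //= odd_double addbT.
Qed.

Lemma ext_SP c a b : src c = objS a -> tgt c = objP b -> deg c = 0 /\ b = ~~ a.
Proof. by case: c => // v [<-] [<-]; rewrite negbK. Qed.

Lemma ext_PS c a b : src c = objP a -> tgt c = objS b -> deg c = 0 /\ b = a.
Proof. by case: c => // v [<-] [<-]. Qed.

Lemma ext_PP c a b : src c = objP a -> tgt c = objP b -> deg c = 0.
Proof. by case: c. Qed.

Lemma is_id_sx0 v : is_id (sx v 0).
Proof. by rewrite /is_id /= eqxx. Qed.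

Lemma is_id_B1 v : is_id (B1 v).
Proof. exact: eqxx. Qed.

Lemma gen_op_cat_pjs v r (d : nat) u n : u (+) odd n = v (+) odd r.+1 ->
  n = (d + r).+1 ->
  gen_op ((Bp v :: rcons (arrs v r) (Bj (v (+) odd r))) ++ [:: sx u n])
      (sx (v (+) odd d) d).
Proof.
move=> uv nE; rewrite cat_cons cat_rcons nE.
have -> : u = v (+) odd d.
  have := congr1 (fun b => b (+) odd n) uv; rewrite -addbA addbb addbF => ->.
  by rewrite nE -addbA /= oddD; case: (odd d); case: (odd r); case: (v).
exact: gen_op_pjs.
Qed.

(** * Trees *)

Section Transfer.
Variables (k : fieldType) (i : basis -> fam k) (p : fam k -> basis -> k).
Variable H : fam k -> fam k.
Hypothesis retract : homotopy_retract i p H.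
Hypothesis cycles : chosen_cycles i.
Hypothesis homotopy : chosen_homotopy i H.
Implicit Types (bs : seq basis) (x y z : obj).

Lemma H_scale x y d a f : is_hom x y d f -> H (fscale a f) = fscale a (H f).
Proof.
move=> hf; have h0 : H (fam0 k) = fam0 k.
  (* Linearity at f = g = 0 with coefficient -1 reads H 0 = - H 0 + H 0. *)
  have := H_linear retract (-1) (is_hom0 k x y d) (is_hom0 k x y d).
  rewrite fscale0 fadd0 => ->; apply: fam_ext => *.
  by rewrite /fadd /fscale scaleN1r addNr.
by have := H_linear retract a hf (is_hom0 k x y d); rewrite !fadd0 h0 fadd0.
Qed.

Lemma H_fam0 : H (fam0 k) = fam0 k.
Proof.
rewrite -{1}(fscale0 0) (H_scale _ (is_hom0 k (objS v1) (objS v1) 0)).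
by apply: fam_ext => *; apply: scale0r.
Qed.

Lemma p_scale x y d a f b : is_hom x y d f -> p (fscale a f) b = a * p f b.
Proof.
move=> hf; have h0 : p (fam0 k) b = 0.
  have := p_linear retract (-1) (is_hom0 k x y d) (is_hom0 k x y d) b.
  by rewrite fscale0 fadd0 mulN1r addNr.
by have := p_linear retract a hf (is_hom0 k x y d) b; rewrite !fadd0 h0 addr0.
Qed.

Lemma p_fam0 b : p (fam0 k) b = 0.
Proof.
by rewrite -(fscale0 0) (p_scale _ _ (is_hom0 k (objS v1) (objS v1) 0)) mul0r.
Qed.

Definition edge (T : tree) (F : int * fam k) : int * fam k :=
  if T is Leaf then F else Hmap H F.

Lemma phom_edge T bs : bs != [::] -> leaves T = size bs -> composable bs ->
  phom (bsrc bs) (btgt bs) (edge T (tree_mu i H T bs)).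
Proof.
elim: T bs => [|l IHl r IHr] [|b bs] // _.
  by case: bs => // _ _; apply: (i_hom retract).
set bs' := b :: bs; move=> lr; rewrite -(cat_take_drop (leaves l) bs').
have st : size (take (leaves l) bs') = leaves l.
  by rewrite size_takel // -lr leq_addr.
have sd : size (drop (leaves l) bs') = leaves r by rewrite size_drop -lr addKn.
have t0 : take (leaves l) bs' != [::] by rewrite -size_eq0 st -lt0n leaves_gt0.
have d0 : drop (leaves l) bs' != [::] by rewrite -size_eq0 sd -lt0n leaves_gt0.
rewrite composable_cat // => /and3P[ct cd /eqP std].
rewrite bsrc_cat // btgt_cat // cat_take_drop.
have hl := IHl _ t0 (esym st) ct; have hr := IHr _ d0 (esym sd) cd.
have hm : phom (bsrc (drop (leaves l) bs')) (btgt (take (leaves l) bs'))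
    (tree_mu i H (Node l r) bs').
  by apply: phom_mu2 hr _; rewrite -std.
by apply/is_homZ/(H_hom retract).
Qed.

(* The value of the only tree that does not vanish on the inputs bs. *)
Definition comb_val bs := edge (comb bs) (tree_mu i H (comb bs) bs).

Lemma comb_val1 b : comb_val [:: b] = (deg b, i b).
Proof. by rewrite /comb_val comb1. Qed.

Lemma phom_comb_val bs : bs != [::] -> composable bs ->
  phom (bsrc bs) (btgt bs) (comb_val bs).
Proof. by move=> b0 cb; apply: phom_edge; rewrite ?leaves_comb. Qed.

Lemma comb_val_cat b c : b != [::] -> c != [::] ->
  comb (b ++ c) = Node (comb b) (comb c) ->
  comb_val (b ++ c) = Hmap H (mu2 (comb_val b) (comb_val c)).
Proof.
move=> b0 c0 bc; rewrite {1}/comb_val bc /=.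
by rewrite leaves_comb // take_size_cat // drop_size_cat.
Qed.

Lemma comb_val_rcons bs e : bs != [::] -> ~~ is_ext (last oneP1 bs) ->
  ~~ is_ext e ->
  comb_val (rcons bs e) = Hmap H (mu2 (comb_val bs) (comb_val [:: e])).
Proof.
move=> b0 be ee; rewrite -cats1 comb_val_cat // cats1 comb_rcons //.
by rewrite comb1.
Qed.

Lemma comb_val_cons bs g : bs != [::] -> is_ext (last oneP1 bs) ->
  comb_val (g :: bs) = Hmap H (mu2 (comb_val [:: g]) (comb_val bs)).
Proof.
move=> b0 be; rewrite -cat1s comb_val_cat //= comb1.
exact: comb_cons.
Qed.

Lemma Hmap_mu2 x y z G F : phom x y F -> phom y z G ->
  (Hmap H (mu2 G F)).2 =
  fscale (sgn k (G.1 + F.1) * sgn k F.1) (H (fcomp F.1 G.2 F.2)).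
Proof.
by move=> hF hG; rewrite /Hmap /mu2 /= (H_scale _ (is_hom_comp hF hG)) fscaleA.
Qed.

Lemma Hmap_mu2_value x y z G F o : phom x y F -> phom y z G ->
  is_value o (H (fcomp F.1 G.2 F.2)) -> is_value o (Hmap H (mu2 G F)).2.
Proof.
move=> hF hG; rewrite (Hmap_mu2 hF hG).
case: o => [h|/= ->]; last by rewrite fscale0.
by apply: eqpmZ; rewrite -sgnD; apply: sgn_pm.
Qed.

(** * Values of the combs *)

Definition has_val bs h :=
  (comb_val bs).1 = hdeg h /\ eqpm (comb_val bs).2 (hmap k h).

Lemma value_bb g f : composable [:: g; f] ->
  is_value (H_bb g f) (Hmap H (mu2 (comb_val [:: g]) (comb_val [:: f]))).2.
Proof.
move=> /= /andP[/eqP gf _]; rewrite !comb_val1.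
apply: (@Hmap_mu2_value (src f) (tgt f) (tgt g)); first exact: (i_hom retract).
  by rewrite -gf; apply: (i_hom retract).
exact: (H_prod_bb homotopy).
Qed.

Lemma value_hb bs h f : hword bs h -> has_val bs h -> hsrc h = tgt f ->
  is_value (H_hb h f) (Hmap H (mu2 (comb_val bs) (comb_val [:: f]))).2.
Proof.
move=> bh [bd bv] hf; have [cb bs_src bs_tgt] := hwordP bh.
have hb := phom_comb_val (hword_neq0 bh) cb.
rewrite comb_val1; apply: (@Hmap_mu2_value (src f) (tgt f)).
- exact: (i_hom retract).
- by rewrite -hf -bs_src; exact: hb.
by apply: (H_prod_hb homotopy); rewrite ?(h_occurs_hword bh).
Qed.

Lemma value_bh bs h g : hword bs h -> has_val bs h -> src g = htgt h ->
  is_value (H_bh g h) (Hmap H (mu2 (comb_val [:: g]) (comb_val bs))).2.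
Proof.
move=> bh [bd bv] hg; have [cb bs_src bs_tgt] := hwordP bh.
have hb := phom_comb_val (hword_neq0 bh) cb.
rewrite comb_val1; apply: (@Hmap_mu2_value (bsrc bs) (btgt bs)) => //.
  by rewrite bs_tgt -hg; apply: (i_hom retract).
by rewrite bd; apply: (H_prod_bh homotopy); rewrite ?(h_occurs_hword bh).
Qed.

Lemma value_hh bs h bs' h' : hword bs h -> has_val bs h ->
  hword bs' h' -> has_val bs' h' -> hsrc h = htgt h' ->
  (Hmap H (mu2 (comb_val bs) (comb_val bs'))).2 = fam0 k.
Proof.
move=> bh [bd bv] bh' [bd' bv'] hh; have [cb bs_src bs_tgt] := hwordP bh.
have [cb' bs_src' bs_tgt'] := hwordP bh'.
have hb := phom_comb_val (hword_neq0 bh) cb.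
have hb' := phom_comb_val (hword_neq0 bh') cb'.
have hb1 : phom (btgt bs') (btgt bs) (comb_val bs) by rewrite bs_tgt' -hh
  -bs_src.
apply: (Hmap_mu2_value (o := None) hb' hb1).
rewrite bd'; apply: (H_prod_hh homotopy) hh bv bv'.
  exact: (h_occurs_hword bh).
exact: (h_occurs_hword bh').
Qed.

(** Indexed by degree, the table of H no longer depends on parity: one more arrow or j on the right
    raises the index by one. *)
Lemma H_hb_hSP v r f : H_hb (hSP v r.+1) f =
  match f with
  | Ba _ => Some (hSP v r.+2) | Bj _ => Some (hSS v r.+2) | _ => None
  end.
Proof.
rewrite /hSP /hSS /= negbK; case: (boolP (odd r)) => od /=; last first.
  by rewrite uphalf_half (negbTE od) add0n; case: f.
have [n ->] : exists n, r = n.*2.+1 by exists r./2; lia.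
by rewrite /= uphalf_double doubleK; case: f.
Qed.

Lemma H_bh_hPS v d g : H_bh g (hPS v d) =
  match g, d with Ba _, d'.+1 => Some (hPS v d') | _, _ => None end.
Proof.
case: g => // u; rewrite /hPS; case: d => [|d] //=.
case: (boolP (odd d)) => od /=; last by rewrite uphalf_half (negbTE od) add0n.
have [n ->] : exists n, d = n.*2.+1 by exists d./2; lia.
by rewrite /= doubleK uphalf_double.
Qed.

Lemma H_bb_jx v d :
  H_bb (Bj v) (sx (v (+) odd d) d.+1) = Some (hPS (v (+) odd d) d).
Proof.
rewrite /sx /hPS /=; case: (boolP (odd d)) => od /=; last first.
  by rewrite uphalf_half (negbTE od) add0n addbF.
have [n ->] : exists n, d = n.*2.+1 by exists d./2; lia.
by rewrite /= doubleK uphalf_double.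
Qed.

Lemma lword_val bs h : lword bs h -> has_val bs h.
Proof.
have edgeP G F o : is_value (Some o) (Hmap H (mu2 G F)).2 ->
    G.1 + F.1 - 1 = hdeg o ->
    (Hmap H (mu2 G F)).1 = hdeg o /\ eqpm (Hmap H (mu2 G F)).2 (hmap k o).
  by [].
have val_a v r : has_val (Bp v :: arrs v r.+1) (hSP v r.+1).
  elim: r => [|r IH].
    rewrite /has_val (comb_val_rcons (bs := [:: Bp v])) //.
    apply: edgeP; last by rewrite !comb_val1.
    by apply: (value_bb (g := Bp v) (f := Ba (~~ v))); rewrite /= negbK eqxx.
  have w := or_introl (lword_a v r) : hword _ _.
  have [_ _ dr] := hSPE v r.+1; have [s _ dr'] := hSPE v r.+2.
  rewrite arrsSr -rcons_cons /has_val comb_val_rcons //; last first.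
    by rewrite (last_lword (lword_a v r)).
  apply: edgeP; last by rewrite (proj1 IH) comb_val1 dr dr' /=; lia.
  have := value_hb (f := Ba (v (+) odd r.+2)) w IH; rewrite H_hb_hSP; apply.
  by have [-> _ _] := hSPE v r.+1; rewrite /= addbN negbK.
case=> v r //; rewrite -rcons_cons /has_val comb_val_rcons //; last first.
  by case: r => // r; rewrite (last_lword (lword_a v r)).
have [_ _ dr'] := hSSE v r.+1.
case: r dr' => [|r] dr'.
  apply: edgeP; last by rewrite !comb_val1.
  by rewrite /= addbF; apply: (value_bb (g := Bp v) (f := Bj v));
    rewrite /= eqxx.
have [_ _ dr] := hSPE v r.+1.
have w := or_introl (lword_a v r) : hword _ _.
apply: edgeP; last by rewrite (proj1 (val_a v r)) comb_val1 dr dr' /=; lia.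
have := value_hb (f := Bj (v (+) odd r.+1)) w (val_a v r).
by rewrite H_hb_hSP; apply; have [-> _ _] := hSPE v r.+1.
Qed.

Lemma rword_val bs h : rword bs h -> has_val bs h.
Proof.
have edgeP G F o : is_value (Some o) (Hmap H (mu2 G F)).2 ->
    G.1 + F.1 - 1 = hdeg o ->
    (Hmap H (mu2 G F)).1 = hdeg o /\ eqpm (Hmap H (mu2 G F)).2 (hmap k o).
  by [].
case=> v r; elim: r v => [|r IH] v d.
  have [_ _ dd] := hPSE (v (+) odd d) d.
  rewrite /= addbF addn0 /has_val comb_val_cons //; last exact: is_ext_sx.
  apply: edgeP; last by rewrite !comb_val1 deg_sx dd /=; lia.
  have /value_bb : composable [:: Bj v; sx (v (+) odd d) d.+1].
    by rewrite /= tgt_sx -addbA /= addbN addbb addbT eqxx.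
  by rewrite H_bb_jx.
(* The tail carries one H fewer, so it is the word for [~~ v] with d + 1 in place of d. *)
have := rword_jx (~~ v) r d.+1; have := IH (~~ v) d.+1.
rewrite [odd r.+1]/= [odd d.+1]/= addbN !addNb negbK addSnnS => val w.
rewrite /= addbN /has_val comb_val_cons; last 2 first.
- exact: (hword_neq0 (or_intror w)).
- exact: (last_rword w).
have [_ tg dd'] := hPSE (v (+) odd d) d.+1.
have [_ _ dd] := hPSE (v (+) odd d) d.
apply: edgeP; last by rewrite (proj1 val) comb_val1 dd dd' /=; lia.
have := value_bh (g := Ba (~~ v)) (or_intror w) val; rewrite H_bh_hPS; apply.
by rewrite tg /= addbN -addbA addbb addbF.
Qed.

Lemma hword_val bs h : hword bs h -> has_val bs h.
Proof. by case=> [/lword_val|/rword_val]. Qed.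

(** * Reduction of trees to combs *)

Lemma admissible_neq0 bs : admissible bs -> bs != [::].
Proof. by case=> [[b ->]|[h /hword_neq0]]. Qed.

Lemma comb_val_split b c : admissible b -> admissible c ->
  composable (b ++ c) ->
  (comb (b ++ c) = Node (comb b) (comb c) /\ exists h, hword (b ++ c) h) \/
  (Hmap H (mu2 (comb_val b) (comb_val c))).2 = fam0 k.
Proof.
move=> gb gc; rewrite composable_cat ?admissible_neq0 //.
case: gb gc => [[g ->]|[h hb]] [[f ->]|[h' hc]] /and3P[cb cc /eqP bc].
- have gf : composable [:: g; f] by rewrite /= andbT; apply/eqP.
  have := value_bb gf; have -> : comb ([:: g] ++ [:: f]) = Node Leaf Leaf.
    by rewrite /comb /=; case: ifP.
  rewrite !comb1; case E : (H_bb g f) => [h|] V; last by right.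
  left; split=> //; exists h; rewrite /= in gf bc.
  case: g f E bc {gf cb cc V} => // v [] // w.
  + by move=> [<-] [->]; left; have := lword_j w 0; rewrite /= addbF.
  + by move=> [<-] [->]; left; have := lword_a (~~ w) 0; rewrite /= negbK.
  + case=> // n [<-] [<-]; right; have := rword_jx v 0 n.*2.+1.
    rewrite /sx /hPS /= odd_double addn0 /= odd_double /= addbF addbT.
    by rewrite !uphalf_double doubleK.
  + move=> n [<-] [] /(can_inj negbK) <-; right; have := rword_jx v 0 n.*2.
    rewrite /sx /hPS /= odd_double addn0 /= odd_double /= !addbF.
    by rewrite !uphalf_double doubleK.
- have [cc' cs ct] := hwordP hc; have val := hword_val hc.
  have gt : src g = htgt h' by rewrite -ct -bc.
  have := value_bh hc val gt; case: hc => [] wc.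
    have -> : H_bh g h' = None; last by right.
    by case: wc {cc cs ct val gt bc cc'} => v r; case: g {cb} => // u;
      rewrite /hSP /hSS /=; case: ifP.
  have wx := last_rword wc;
    case: wc cc cs ct bc gt val wx => v r d cc cs ct bc gt val wx.
  rewrite H_bh_hPS; case: g cb bc gt => [u|u|u|u|u n|u n] cb bc gt;
    try by right.
  case: d cc cs ct bc gt val wx => [|d] cc cs ct bc gt val wx; first by right.
  left; split; first by rewrite comb1; apply: comb_cons => //; case: (r).
  exists (hPS (v (+) odd d.+1) d); right.
  have [_ tg _] := hPSE (v (+) odd d.+1) d.+1; move: gt.
  rewrite tg -addbA addbb addbF /= => -[->].
  have := rword_jx (~~ v) r.+1 d; rewrite /= negbK !addbN !addNb negbK.
  by rewrite addnS.
- have [cc' cs ct] := hwordP hb; have val := hword_val hb.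
  have sf : hsrc h = tgt f by rewrite -cs bc.
  have := value_hb hb val sf; case: hb => [] wb; last first.
    have -> : H_hb h f = None; last by right.
    by case: wb {cb cs ct val sf bc cc'} => v r d; rewrite /hPS; case: ifP.
  have we := last_lword wb.
  case: wb cb cs ct bc sf val we => v r cb cs ct bc sf val we; last first.
    have -> : H_hb (hSS v r.+1) f = None; last by right.
    by rewrite /hSS; case: ifP.
  have [hs _ _] := hSPE v r.+1; rewrite H_hb_hSP; rewrite hs in sf.
  case: f cc bc sf => [u|u|u|u|u n|u n] cc bc [sf]; try by right.
    left; rewrite cats1 comb_rcons ?we // comb1; split=> //.
    exists (hSS v r.+2); left; rewrite -sf. exact: (lword_j v r.+1).
  left; rewrite cats1 comb_rcons ?we // comb1; split=> //.
  exists (hSP v r.+2); left; have := lword_a v r.+1.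
  by rewrite [arrs _ r.+2]arrsSr -rcons_cons [odd r.+2]/= addbN sf negbK.
have [_ cs ct] := hwordP hb; have [_ cs' ct'] := hwordP hc.
right; apply: value_hh hb (hword_val hb) hc (hword_val hc) _.
by rewrite -cs bc.
Qed.

(** By induction both subtrees are combs of admissible words or their product is 0; [comb_val_split]
    then decides about the node. *)
Lemma edge_comb T bs : bs != [::] -> leaves T = size bs -> composable bs ->
  (T = comb bs /\ admissible bs) \/ (edge T (tree_mu i H T bs)).2 = fam0 k.
Proof.
elim: T bs => [|l IHl r IHr] [|b bs] // _.
  by case: bs => // _ _; left; rewrite comb1; split=> //; left; exists b.
set bs' := b :: bs; move=> lr.
have st : size (take (leaves l) bs') = leaves l.
  by rewrite size_takel // -lr leq_addr.
have sd : size (drop (leaves l) bs') = leaves r by rewrite size_drop -lr addKn.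
have t0 : take (leaves l) bs' != [::] by rewrite -size_eq0 st -lt0n leaves_gt0.
have d0 : drop (leaves l) bs' != [::] by rewrite -size_eq0 sd -lt0n leaves_gt0.
have cbs : bs' = take (leaves l) bs' ++ drop (leaves l) bs'.
  by rewrite cat_take_drop.
move=> cb; have := cb; rewrite cbs composable_cat // => /and3P[ct cd _].
rewrite -cbs -[edge _ _]/(Hmap H (mu2
  (edge l (tree_mu i H l (take (leaves l) bs')))
  (edge r (tree_mu i H r (drop (leaves l) bs'))))).
have zero G F : G.2 = fam0 k \/ F.2 = fam0 k -> (Hmap H (mu2 G F)).2 = fam0 k.
  by rewrite /= => -[] ->; rewrite ?fcomp0l ?fcomp0r fscale0 H_fam0 fscale0.
case: (IHr _ d0 (esym sd) cd) => [[-> gd]|zr]; last by right; auto.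
case: (IHl _ t0 (esym st) ct) => [[El gt]|zl]; last by right; auto.
have ccat : composable (take (leaves l) bs' ++ drop (leaves l) bs').
  by rewrite cat_take_drop.
have [[eT [h hw]]|z] := comb_val_split gt gd ccat.
  rewrite cat_take_drop in eT hw.
  by left; split; [rewrite eT; congr Node|right; exists h].
right; rewrite -[RHS]z; congr (Hmap H (mu2 _ _)).2.
by rewrite /comb_val -El.
Qed.

(** The root carries p instead of H, so the two words below it need not join to an admissible word:
    every position of the cut may contribute, each through one pair of combs. *)
Lemma m_op_splits bs c : composable bs -> (1 < size bs)%N ->
  m_op i p H bs c = \sum_(s <- iota 1 (size bs).-1)
    p (mu2 (comb_val (take s bs)) (comb_val (drop s bs))).2 c.
Proof.
case: bs => [|b1 [|b2 bs]] //; set w := _ :: _; set n := size w => cb _.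
have -> : m_op i p H w c = \sum_(T <- trees n) p (tree_mu i H T w).2 c by [].
have -> : trees n = flatten [seq [seq Node l r | l <- trees_rec n.-1 s,
    r <- trees_rec n.-1 (n - s)] | s <- iota 1 n.-1] by [].
rewrite big_flatten big_map; apply: eq_big_seq => s.
rewrite mem_iota add1n ltnS => /andP[s0 sn]; rewrite big_allpairs_dep.
have st : size (take s w) = s by rewrite size_takel // -/n; lia.
have sd : size (drop s w) = (n - s)%N by rewrite size_drop.
have t0 : take s w != [::] by rewrite -size_eq0 st -lt0n.
have d0 : drop s w != [::] by rewrite -size_eq0 sd; lia.
have := cb; rewrite -[w in composable w](cat_take_drop s) composable_cat //.
move=> /and3P[ct cd _].
have valE l r : leaves l = s -> tree_mu i H (Node l r) w =
    mu2 (edge l (tree_mu i H l (take s w))) (edge r (tree_mu i H r (drop s w))).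
  by move=> <-.
have lcb : leaves (comb (take s w)) = s by rewrite leaves_comb.
rewrite (sum_seq1 (j := comb (take s w))); first last.
- move=> l; rewrite mem_trees_rec // => /eqP ls lc.
  rewrite big1 // => r _; rewrite valE //.
  have [||//|[lE _]|z] := @edge_comb l (take s w); rewrite ?st //.
    by rewrite lE eqxx in lc.
  by rewrite /mu2 /= z fcomp0l fscale0 p_fam0.
- exact: uniq_trees_rec.
- by rewrite mem_trees_rec ?lcb.
rewrite (sum_seq1 (j := comb (drop s w))) ?valE //.
- by rewrite mem_trees_rec ?leaves_comb ?sd //; lia.
- by apply: uniq_trees_rec; lia.
move=> r; rewrite mem_trees_rec; last lia.
move=> /eqP rs rc; rewrite valE //.
have [||//|[rE _]|z] := @edge_comb r (drop s w); rewrite ?sd //.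
  by rewrite rE eqxx in rc.
by rewrite /mu2 /= z fcomp0r fscale0 p_fam0.
Qed.

(** * Boundaries *)

(** In 1 - ip = d(H) the term H(dw) is 0 as w is closed, and ip w is 0 as Ext^* vanishes in its
    degree. The sign arises because [Hmap] and [bdiff] use (-1)^|f| in degrees that differ by
    one. *)
Lemma bdiff_Hmap x y w : phom x y w -> dEnd w.1 w.2 = fam0 k ->
  ext_basis x y w.1 = [::] -> bdiff (Hmap H w) = pscale (-1) w.
Proof.
move=> hw dw ew; rewrite /bdiff /Hmap /pscale /= subrK; congr pair.
have := ip_homotopy retract hw; rewrite dw H_fam0 fadd0.
have -> : ipmap i p x y w.1 w.2 = fam0 k.
  by apply: fam_ext => *; rewrite /ipmap ew big_nil.
rewrite fscale0 fadd0 dEndZ fscaleA => <-; congr fscale.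
by rewrite sgnD sgnN1 mulrN1 mulNr sgnK.
Qed.

Lemma bdiff1 b : (bdiff (comb_val [:: b])).2 = fam0 k.
Proof. by apply/bdiff_eq0; rewrite comb_val1; apply: (i_cycle retract). Qed.

Lemma mu2_cycles_closed g f :
  dEnd (mu2 (comb_val [:: g]) (comb_val [:: f])).1
    (mu2 (comb_val [:: g]) (comb_val [:: f])).2 = fam0 k.
Proof.
apply/bdiff_eq0; rewrite bdiff_mu2 mu2_0r ?bdiff1 // mu2_0l ?bdiff1 //.
by rewrite !fscale0 fadd0.
Qed.

Lemma mu2_arrow0 g f : arrow_like g -> arrow_like f ->
  (mu2 (comb_val [:: g]) (comb_val [:: f])).2 = fam0 k.
Proof.
move=> ag af; rewrite /mu2 !comb_val1 /=.
have sh b : arrow_like b -> eqpm (i b) (arrow_fam k (src b) (tgt b) (deg b)).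
  by move=> ab; have := (proj1 cycles) b; case: b ab.
by rewrite (arrow_comp0 _ (sh g ag) (sh f af)) fscale0.
Qed.

(** What is known of a factor at the root: its endpoints, its degree, and its shape up to a sign in
    each component. *)
Record value (bs : seq basis) x y d (b : bool) : Prop := Value {
  val_neq0 : bs != [::];
  val_composable : composable bs;
  val_src : bsrc bs = x;
  val_tgt : btgt bs = y;
  val_deg : (comb_val bs).1 = d;
  val_shape : eqpm (comb_val bs).2 (shape_fam k b x y d) }.

Lemma val_hom bs x y d b : value bs x y d b -> phom x y (comb_val bs).
Proof. by case=> b0 cb <- <- _ _; apply: phom_comb_val. Qed.

Lemma value1 b : value [:: b] (src b) (tgt b) (deg b) (arrow_like b).
Proof.
split=> //; rewrite comb_val1 //=.
by have := proj1 cycles b; case: b.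
Qed.

Lemma value_sx v d : value [:: sx v d] (objS v) (objS (v (+) odd d)) d%:Z false.
Proof.
have := value1 (sx v d); rewrite src_sx tgt_sx deg_sx.
by have -> : arrow_like (sx v d) = false by rewrite /sx; case: ifP.
Qed.

Lemma value_hword bs h : hword bs h ->
  value bs (hsrc h) (htgt h) (hdeg h) false.
Proof.
move=> hb; have [cb bs_src bs_tgt] := hwordP hb.
have [bd bv] := hword_val hb.
by split=> //; apply: hword_neq0 hb.
Qed.

Lemma value_parrs v r :
  value (Bp v :: arrs v r) (objP (v (+) odd r)) (objS v) (- r%:Z) false.
Proof.
case: r => [|r]; first by rewrite addbF; apply: (value1 (Bp v)).
have := value_hword (or_introl (lword_a v r)).
by have [-> -> ->] := hSPE v r.+1.
Qed.

Lemma value_pj v r :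
  value (Bp v :: rcons (arrs v r) (Bj (v (+) odd r)))
        (objS (v (+) odd r.+1)) (objS v) (- r.+1%:Z) false.
Proof.
have := value_hword (or_introl (lword_j v r)).
by have [-> -> ->] := hSSE v r.+1.
Qed.

Lemma value_jx v r d :
  value (arrs v r ++ [:: Bj (v (+) odd r); sx (v (+) odd d) (d + r).+1])
        (objS (v (+) odd d)) (objP v) d%:Z false.
Proof.
have := value_hword (or_intror (rword_jx v r d)).
by have [-> -> ->] := hPSE (v (+) odd d) d; rewrite -addbA addbb addbF.
Qed.

(** Closedness: the boundary of the product of p a ... a with e contains, after reassociation, the
    product of the last arrow with e, which is 0. The degree of the product is -r; for r = 0 there
    is no morphism of degree 0 from P_(v+1) or S_(v+1) to S_v. *)
Lemma parrs_bdiff v r e :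
  e = Ba (v (+) odd r.+1) \/ e = Bj (v (+) odd r) ->
  bdiff (comb_val (rcons (Bp v :: arrs v r) e)) =
  pscale (-1) (mu2 (comb_val (Bp v :: arrs v r)) (comb_val [:: e])).
Proof.
have last_a s : ~~ is_ext (last oneP1 (Bp v :: arrs v s)).
  by case: s => // s; rewrite (last_lword (lword_a v s)).
have ext0 s f c : f = Ba (v (+) odd s.+1) \/ f = Bj (v (+) odd s) ->
    src c = src f -> tgt c = objS v -> deg c = - s%:Z + deg f -> False.
  move=> he sc tc dc; have dc0 := deg_ge0 c.
  have s0 : s = 0%N by case: he dc => -> /=; lia.
  subst s; have dc' : deg c = 0 by case: he dc => -> /=.
  have {he} : src c = objP (~~ v) \/ src c = objS (~~ v).
    by rewrite sc; case: he => ->; rewrite /= ?addbT ?addbF; auto.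
  case: c tc dc' {sc dc dc0} => [u|u|u|u|u n|u n] //= [->] // _; case=> -[];
    by case: (v).
have main s f : f = Ba (v (+) odd s.+1) \/ f = Bj (v (+) odd s) ->
    (bdiff (mu2 (comb_val (Bp v :: arrs v s)) (comb_val [:: f]))).2 = fam0 k ->
    bdiff (comb_val (rcons (Bp v :: arrs v s) f)) =
    pscale (-1) (mu2 (comb_val (Bp v :: arrs v s)) (comb_val [:: f])).
  move=> hf /bdiff_eq0 closed; rewrite comb_val_rcons //;
    last by case: hf => ->.
  have vp := value_parrs v s; apply: (@bdiff_Hmap (src f) (objS v)) => //.
    apply: phom_mu2 (val_hom vp); rewrite comb_val1.
    have -> : objP (v (+) odd s) = tgt f; last exact: (i_hom retract).
    by case: hf => -> /=; rewrite ?addbN ?negbK.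
  apply: ext_nil => c sc tc dc; apply: (ext0 s f c) => //.
  by rewrite dc /= (val_deg vp) comb_val1.
elim: r e => [|r IH] e he; apply: main => //.
  by apply/bdiff_eq0; apply: mu2_cycles_closed.
rewrite bdiff_mu2 mu2_0r ?bdiff1 // fscale0 add0f.
have -> : Bp v :: arrs v r.+1 = rcons (Bp v :: arrs v r) (Ba (v (+) odd r.+1)).
  by rewrite arrsSr.
rewrite IH; last by left.
have -> : (mu2 (pscale (-1) (mu2 (comb_val (Bp v :: arrs v r))
    (comb_val [:: Ba (v (+) odd r.+1)]))) (comb_val [:: e])).2 = fam0 k.
  rewrite /pscale mu2Zl -surjective_pairing mu2A mu2_0r ?fscale0 //.
  by apply: mu2_arrow0 => //; case: he => ->.
exact: fscale0.
Qed.

Lemma lword_bdiff bs e h : lword (rcons bs e) h ->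
  bdiff (comb_val (rcons bs e)) =
    pscale (-1) (mu2 (comb_val bs) (comb_val [:: e])).
Proof.
move E : (rcons bs e) => w lw; case: lw E => v r.
  rewrite arrsSr -rcons_cons => /rcons_inj[-> ->].
  by rewrite parrs_bdiff //; left.
by rewrite -rcons_cons => /rcons_inj[-> ->]; rewrite parrs_bdiff //; right.
Qed.

(** The mirror image of [lword_bdiff]. The product has degree d + 1, while Ext^*(S, P) is
    concentrated in degree 0. *)
Lemma rword_bdiff bs g h : rword (g :: bs) h ->
  bdiff (comb_val (g :: bs)) =
    pscale (-1) (mu2 (comb_val [:: g]) (comb_val bs)).
Proof.
have ext0 (u w : vertex) d c : src c = objS u -> tgt c = objP w ->
  deg c = d%:Z -> d = 0%N.
  by case: c => //= v' _ _ /eqP; rewrite eqz_nat eq_sym => /eqP.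
(* Splitting off the head treats a first letter a and a first letter j alike. *)
have main v r d (w := arrs v r ++ [:: Bj (v (+) odd r);
      sx (v (+) odd d) (d + r).+1]) :
    bdiff (comb_val w) =
      pscale (-1) (mu2 (comb_val [:: head oneP1 w]) (comb_val (behead w))).
  elim: r v d @w => [|r IH] v d w.
    have -> : w = [:: Bj v; sx (v (+) odd d) d.+1].
      by rewrite /w /= addbF addn0.
    rewrite [head _ _]/= [behead _]/= comb_val_cons //; last exact: is_ext_sx.
    apply: (@bdiff_Hmap (objS (v (+) odd d)) (objP v)).
    - apply: phom_mu2; first exact: val_hom (value_sx _ _).
      have := val_hom (value1 (Bj v)); congr phom; rewrite /=.
      by rewrite -addbA addbN addbb addbT.
    - exact: mu2_cycles_closed.
    apply: ext_nil => c sc tc; rewrite !comb_val1 deg_sx /= add0r => dc.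
    by have := ext0 _ _ d.+1 _ sc tc dc.
  have jx := rword_jx (~~ v) r d.+1; have val := value_jx (~~ v) r d.+1.
  have := IH (~~ v) d.+1; move: jx val.
  have -> : arrs (~~ v) r ++ [:: Bj (~~ v (+) odd r);
      sx (~~ v (+) odd d.+1) (d.+1 + r).+1] = behead w.
    by rewrite /w /= !addNb !addbN negbK addSnnS.
  move=> jx val bd.
  have -> : w = Ba (~~ v) :: behead w by [].
  set w' := behead w in jx val bd *.
  rewrite /= comb_val_cons ?(val_neq0 val) ?(last_rword jx) //.
  apply: (@bdiff_Hmap (objS (~~ v (+) odd d.+1)) (objP v)).
  - apply: phom_mu2 (val_hom val) _; have := val_hom (value1 (Ba (~~ v))).
    by rewrite /= negbK.
  - apply/bdiff_eq0; rewrite bdiff_mu2.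
    have -> : (mu2 (bdiff (comb_val [:: Ba (~~ v)])) (comb_val w')).2 = fam0 k.
      by apply: mu2_0l; apply: bdiff1.
    rewrite bd [X in fscale _ X](_ : _ = fam0 k) ?fscale0 ?fadd0 //.
    rewrite /pscale mu2Zr -surjective_pairing.
    have a0 : (mu2 (comb_val [:: Ba (~~ v)]) (comb_val [:: head oneP1 w'])).2 =
      fam0 k.
      by apply: mu2_arrow0 => //; rewrite /w' /w; case: (r).
    have := mu2A (comb_val [:: Ba (~~ v)]) (comb_val [:: head oneP1 w'])
      (comb_val (behead w')).
    rewrite (mu2_0l _ a0) => /(congr1 (fscale (sgn k (comb_val (behead
      w')).1))).
    by rewrite fscaleA sgnK fscale1 => <-; rewrite !fscale0.
  apply: ext_nil => c sc tc; rewrite comb_val1 /= (val_deg val) add0r => dc.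
  by have := ext0 _ _ d.+1 _ sc tc dc.
by move E : (g :: bs) => w rw; case: rw E => v r d E; rewrite main -E.
Qed.

(** * The operations in the list *)

(** The difference of T and a suitable multiple of i c has a zero component in degree -d, so it
    vanishes by [hom_ext_eq0], and p T is this multiple of c. *)
Lemma p_value x z d T c (s : bool) : c \in ext_basis x z d ->
  is_hom x z d T -> (is_inl x && is_inl z -> dEnd d T = fam0 k) ->
  T x z (- d) 0 = (-1) ^+ s *: cycle_shape k c x z (- d) 0 ->
  equals_pm (p T) c.
Proof.
move=> cxz hT dT T0.
have hc : is_hom x z d (i c).
  have := i_hom retract c; move: cxz; rewrite mem_ext_basis.
  by move=> /and3P[/eqP-> /eqP-> /eqP->].
have dc : dEnd d (i c) = fam0 k.
  have := i_cycle retract c; move: cxz; rewrite mem_ext_basis.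
  by move=> /and3P[_ _ /eqP->].
have [t ct] := eqpmP x z (- d) 0 (proj1 cycles c).
pose a : k := (-1) ^+ (s (+) t).
have Ta : fadd (fscale (- a) (i c)) T = fam0 k.
  apply: (hom_ext_eq0 cxz).
  - exact: is_homD (is_homZ _ hc) hT.
  - by move=> xz; rewrite dEndD dEndZ dc fscale0 add0f dT.
  rewrite /fadd /fscale T0 ct scalerA mulNr -signr_addb -addbA addbb addbF.
  by rewrite scaleNr addNr.
exists (s (+) t) => b.
have := p_linear retract (- a) hc hT b.
rewrite Ta (p_fam0) (pi_id retract) => /esym/eqP.
by rewrite mulNr addrC subr_eq0 => /eqP ->; rewrite eq_sym.
Qed.

Lemma phom_value_mu2 b1 b2 x y z d1 d2 a1 a2 :
  value b1 y z d1 a1 -> value b2 x y d2 a2 ->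
    phom x z (mu2 (comb_val b1) (comb_val b2)).
Proof. by move=> v1 v2; apply: phom_mu2 (val_hom v2) (val_hom v1). Qed.

Lemma value_mu2_comp b1 b2 x y z d1 d2 a :
  value b1 y z d1 a -> value b2 x y d2 false ->
  mdim (mterm k y (- d1)) = 2%N ->
  exists s : bool, (mu2 (comb_val b1) (comb_val b2)).2 x z (- (d1 + d2)) 0 =
    (-1) ^+ s *: shape_fam k a x z (d1 + d2) x z (- (d1 + d2)) 0.
Proof.
move=> v1 v2 y2; rewrite (addrC d1).
have := val_hom v2; rewrite /phom (val_deg v2) => h2.
have [s e] := comp_shape h2 (val_shape v2) (val_shape v1) y2.
rewrite /mu2 /= /fscale (val_deg v2) e scalerA.
by case: (sgn_pm k d2) => ->; [exists s|exists (~~ s)];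
  rewrite ?mul1r // mulN1r signrN.
Qed.

Lemma split_value b1 b2 x y z d1 d2 a c :
  value b1 y z d1 a -> value b2 x y d2 false ->
  mdim (mterm k y (- d1)) = 2%N ->
  src c = x -> tgt c = z -> deg c = d1 + d2 -> arrow_like c = a ->
  (is_inl x && is_inl z ->
   dEnd (mu2 (comb_val b1) (comb_val b2)).1 (mu2 (comb_val b1) (comb_val b2)).2
     = fam0 k) ->
  equals_pm (p (mu2 (comb_val b1) (comb_val b2)).2) c.
Proof.
move=> w1 w2 y2 sc tc dc ac closed.
have [s e] := value_mu2_comp w1 w2 y2.
have dE : (mu2 (comb_val b1) (comb_val b2)).1 = d1 + d2.
  by rewrite /= (val_deg w1) (val_deg w2).
have := phom_value_mu2 w1 w2; rewrite /phom dE => hm; rewrite dE in closed.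
apply: (p_value (s := s)) hm closed _.
  by rewrite mem_ext_basis sc tc dc !eqxx.
by rewrite e cycle_shapeE sc tc dc ac.
Qed.

Lemma composable_takedrop s bs : (0 < s < size bs)%N -> composable bs ->
  [/\ take s bs != [::], drop s bs != [::], composable (take s bs),
      composable (drop s bs) & bsrc (take s bs) = btgt (drop s bs)].
Proof.
move=> /andP[s0 sn]; have t0 : take s bs != [::].
  by rewrite -size_eq0 size_takel ?(ltnW sn) // -lt0n.
have d0 : drop s bs != [::] by rewrite -size_eq0 size_drop subn_eq0 -ltnNge.
rewrite -{1}(cat_take_drop s bs) composable_cat // => /and3P[-> -> /eqP].
by split.
Qed.

Lemma p_split_admissible s bs c : (0 < s < size bs)%N -> composable bs ->
  p (mu2 (comb_val (take s bs)) (comb_val (drop s bs))).2 c != 0 ->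
  admissible (take s bs) /\ admissible (drop s bs).
Proof.
move=> sn cb; have [t0 d0 ct cd _] := composable_takedrop sn cb.
have [[_ gt]|l0] := edge_comb t0 (leaves_comb t0) ct; last first.
  by rewrite mu2_0l // (p_fam0) eqxx.
have [[_ gd]|r0] := edge_comb d0 (leaves_comb d0) cd; last first.
  by rewrite mu2_0r // (p_fam0) eqxx.
by [].
Qed.

Lemma m_op_cat (b1 b2 : seq basis) x y z d1 d2 a1 a2 c :
  value b1 y z d1 a1 -> value b2 x y d2 a2 ->
  (forall s, (0 < s < size (b1 ++ b2))%N -> admissible (take s (b1 ++ b2)) ->
     admissible (drop s (b1 ++ b2)) -> s = size b1) ->
  m_op i p H (b1 ++ b2) c = p (mu2 (comb_val b1) (comb_val b2)).2 c.
Proof.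
move=> w1 w2 uniq_split; have n1 := val_neq0 w1; have n2 := val_neq0 w2.
have cb : composable (b1 ++ b2).
  rewrite composable_cat // (val_composable w1) (val_composable w2).
  by rewrite (val_src w1) (val_tgt w2) eqxx.
have s1 : (0 < size b1)%N by case: (b1) n1.
have s2 : (0 < size b2)%N by case: (b2) n2.
rewrite (m_op_splits) //; last by rewrite size_cat; lia.
rewrite (sum_seq1 (j := size b1)) ?iota_uniq //.
- by rewrite take_size_cat // drop_size_cat.
- by rewrite mem_iota size_cat; lia.
move=> s; rewrite mem_iota => sn ns; apply/eqP; apply: contraNT ns => ps.
have sn' : (0 < s < size (b1 ++ b2))%N by rewrite size_cat in sn *; lia.
have [gt gd] := p_split_admissible sn' cb ps.
by apply/eqP; apply: uniq_split.
Qed.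

(** Used with [admissible_not_ext] to exclude all but one splitting: a part cut at a wrong place has
    an element of Ext^*(S, S) before its end, or has none and begins with an arrow. *)
Lemma admissible_ext bs : admissible bs -> has is_ext bs -> (1 < size bs)%N ->
  is_ext (last oneP1 bs) && ~~ is_ext (head oneP1 bs).
Proof.
case=> [[b -> //]|[h [/lwordP[_ _ _ /negbTE->] //|rw]]] _ _.
by rewrite (last_rword rw); case: rw => v [|r] d.
Qed.

Lemma admissible_not_ext bs : admissible bs -> ~~ has is_ext bs ->
  (1 < size bs)%N ->
  exists v, head oneP1 bs = Bp v.
Proof.
case=> [[b -> //]|[h [lw|rw]]]; first by move=> _ _; case: lw => v r; exists v.
have [_ _ _ [bs' e /andP[le _]]] := rwordP rw.
by rewrite e has_rcons le.
Qed.

Lemma mdim_S_le0 v n : n <= 0 -> mdim (mterm k (objS v) n) = 2%N.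
Proof. by rewrite mdimS => ->. Qed.

Lemma mdim_P0 v : mdim (mterm k (objP v) (- 0)) = 2%N.
Proof. by rewrite mdimP oppr0. Qed.

Lemma m_op_jp v : equals_pm (m_op i p H [:: Bj v; Bp (~~ v)]) (Ba (~~ v)).
Proof.
have w1 := value1 (Bj v); have w2 := value1 (Bp (~~ v)).
have [s e] : equals_pm
    (p (mu2 (comb_val [:: Bj v]) (comb_val [:: Bp (~~ v)])).2) (Ba (~~ v)).
  apply: (split_value w1 w2) => //.
  by rewrite /= negbK.
exists s => c; rewrite -e; apply: (m_op_cat c w1 w2) => -[|[|s']] //.
Qed.

Lemma m_op_ss v (d e : nat) :
  equals_pm (m_op i p H [:: sx (v (+) odd d) e; sx v d]) (sx v (e + d)).
Proof.
have w1 := value_sx (v (+) odd d) e; have w2 := value_sx v d.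
have [s es] : equals_pm
    (p (mu2 (comb_val [:: sx (v (+) odd d) e]) (comb_val [:: sx v d])).2)
    (sx v (e + d)).
  apply: (split_value w1 w2); rewrite ?src_sx ?tgt_sx ?deg_sx ?arrow_like_sx //.
  - by apply: mdim_S_le0; lia.
  - by rewrite -addbA -oddD addnC.
  - by move=> _; apply: mu2_cycles_closed.
exists s => c; rewrite -es; apply: (m_op_cat c w1 w2) => -[|[|s']] //.
Qed.

Lemma m_op_sp v r :
  equals_pm (m_op i p H (sx v r :: Bp v :: arrs v r)) (Bp (v (+) odd r)).
Proof.
have w1 := value_sx v r; have w2 := value_parrs v r.
have [s es] : equals_pm
    (p (mu2 (comb_val [:: sx v r]) (comb_val (Bp v :: arrs v r))).2)
    (Bp (v (+) odd r)).
  apply: (split_value w1 w2) => //; first by apply: mdim_S_le0; lia.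
  by rewrite subrr.
exists s => c; rewrite -es; apply: (m_op_cat c w1 w2) => s' /andP[s0 sn] gt _.
case: s' s0 sn gt => [|[|s']] // _ sn gt.
by have /= := admissible_ext gt; rewrite is_ext_sx andbF => /(_ isT isT).
Qed.

Lemma m_op_spj v r (d : nat) :
  equals_pm (m_op i p H
    (sx v (d + r).+1 :: Bp v :: rcons (arrs v r) (Bj (v (+) odd r))))
    (sx (~~ (v (+) odd r)) d).
Proof.
have w1 := value_sx v (d + r).+1.
have w2 := value_pj v r.
have [s es] : equals_pm (p (mu2 (comb_val [:: sx v (d + r).+1])
    (comb_val (Bp v :: rcons (arrs v r) (Bj (v (+) odd r))))).2)
    (sx (~~ (v (+) odd r)) d).
  apply: (split_value w1 w2);
    rewrite ?src_sx ?tgt_sx ?deg_sx ?arrow_like_sx //.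
  - by rewrite /= addbN.
  - by rewrite /= oddD addNb -addbA [odd r (+) _]addbC addbN.
  - lia.
  move=> _; apply/bdiff_eq0;
    rewrite bdiff_mu2 [X in fadd _ (fscale _ X)]mu2_0l ?bdiff1 //.
  have -> : Bp v :: rcons (arrs v r) (Bj (v (+) odd r)) =
    rcons (Bp v :: arrs v r) (Bj (v (+) odd r)) by [].
  rewrite (@lword_bdiff (Bp v :: arrs v r) _ _
    (lword_j v r)).
  have w3 := value_parrs v r.
  rewrite /pscale mu2Zr -surjective_pairing.
  (* This product starts at a P and has degree d + 1 > 0. *)
  have x0 : (mu2 (comb_val [:: sx v (d +
    r).+1]) (comb_val (Bp v :: arrs v r))).2 = fam0 k.
    have := phom_value_mu2 w1 w3; apply: homP_eq0.
    by rewrite /= (val_deg w1) (val_deg w3); lia.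
  have := mu2A (comb_val [:: sx v (d + r).+1]) (comb_val (Bp v :: arrs v r))
    (comb_val [:: Bj (v (+) odd r)]).
  rewrite (mu2_0l _ x0) => /(congr1 (fscale (sgn k (comb_val [:: Bj (v (+) odd
    r)]).1))).
  by rewrite fscaleA sgnK fscale1 => <-; rewrite !fscale0 fadd0.
exists s => c; rewrite -es; apply: (m_op_cat c w1 w2) => s' /andP[s0 sn] gt _.
case: s' s0 sn gt => [|[|s']] // _ sn gt.
by have /= := admissible_ext gt; rewrite is_ext_sx andbF => /(_ isT isT).
Qed.

Lemma m_op_ajs v r :
  equals_pm (m_op i p H (arrs v r.+1 ++ [:: Bj (v (+) odd r.+1);
    sx (~~ v) r.+1]))
    (Bj v).
Proof.
have w1 := value1 (Ba (~~ v)).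
(* For d = 0, H kills the product of the arrow with this value, so the product survives only at the
   root. *)
have w2 := value_jx (~~ v) r 0.
have -> : arrs v r.+1 ++ [:: Bj (v (+) odd r.+1); sx (~~ v) r.+1] =
    [:: Ba (~~ v)] ++ (arrs (~~ v) r ++
      [:: Bj (~~ v (+) odd r); sx (~~ v (+) odd 0) (0 + r).+1]).
  by rewrite /= addbF addbN addNb.
set b2 := arrs (~~ v) r ++ _ in w2 *.
have [s es] : equals_pm (p (mu2 (comb_val [:: Ba (~~ v)]) (comb_val b2)).2) (Bj
  v).
  apply: (split_value w1 w2) => //.
  - by rewrite /= addbF.
  - by rewrite /= negbK.
exists s => c; rewrite -es; apply: (m_op_cat c w1 w2) => s' /andP[s0 sn] gt _.
case: s' s0 sn gt => [|[|s']] // _ sn gt.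
have sb2 : size b2 = r.+2 by rewrite size_cat size_arrs /= addn2.
have s'r : (s' <= r)%N by rewrite /= sb2 !ltnS in sn.
have [||u] := admissible_not_ext gt; last by [].
- rewrite /= /b2 -cat1s catA takel_cat ?size_cat ?size_arrs ?addn1 //.
  by apply: hasN_take; rewrite has_cat arrs_not_ext.
by rewrite size_takel // ltnW.
Qed.

Lemma m_op_ajsp v r s :
  equals_pm (m_op i p H (arrs v r ++ [:: Bj (v (+) odd r);
    sx (v (+) odd s) (s + r).+1] ++
           Bp (v (+) odd s) :: arrs (v (+) odd s) s)) (B1 v).
Proof.
have w1 := value_jx v r s.
have w2 := value_parrs (v (+) odd s) s.
rewrite catA; set b1 := arrs v r ++ _ in w1 *; set b2 := Bp _ :: _ in w2 *.
have [t et] : equals_pm (p (mu2 (comb_val b1) (comb_val b2)).2) (B1 v).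
  apply: (split_value w1 w2) => //; first by apply: mdim_S_le0; lia.
  - by rewrite /= -addbA addbb addbF.
  - by rewrite subrr.
exists t => c; rewrite -et; apply: (m_op_cat c w1 w2) => s' /andP[s0 sn] gt gd.
have sb1 : size b1 = r.+2 by rewrite size_cat size_arrs /= addn2.
have nx2 : ~~ has is_ext b2 by rewrite /= arrs_not_ext.
pose X := rcons (arrs v r) (Bj (v (+) odd r)).
have b1E : b1 = rcons X (sx (v (+) odd s) (s + r).+1).
  by rewrite /b1 /X -!cats1 -catA.
have sX : size X = r.+1 by rewrite size_rcons size_arrs.
have ext_last b : admissible b -> has is_ext b -> (1 < size b)%N ->
    is_ext (last oneP1 b).
  by move=> gb hb sb; case/andP: (admissible_ext gb hb sb).
(* A cut before x leaves x inside the right part, and a cut beyond p leaves it inside the left part;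
   in both cases it is not the last letter. *)
have [lt|gt_|//] := ltngtP s' (size b1).
  rewrite drop_cat lt b1E drop_rcons ?sX in gd; last by rewrite sb1 in lt.
  have : is_ext (last oneP1 (rcons (drop s' X) (sx (v (+) odd s) (s +
    r).+1) ++ b2)).
    by apply: ext_last gd _ _; rewrite ?has_cat ?has_rcons ?is_ext_sx //
      size_cat size_rcons /= addSn addnS.
  by rewrite last_cat (negbTE (hasN_last _ _ nx2)).
rewrite take_cat ltnNge (ltnW gt_) /= in gt.
set t' := take _ b2 in gt.
have t0 : t' != [::].
  rewrite -size_eq0 /t' size_takel; last by rewrite leq_subLR -size_cat ltnW.
  by rewrite subn_eq0 -ltnNge.
have : is_ext (last oneP1 (b1 ++ t')).
  apply: ext_last gt _ _; first by rewrite has_cat b1E has_rcons is_ext_sx.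
  by rewrite size_cat sb1.
by rewrite last_cat (negbTE (hasN_last _ t0 (hasN_take _ nx2))).
Qed.

(** * Sums over all splittings *)

Section Telescope.
Variables (x z : obj) (D : int) (bs : seq basis) (n : nat).
Hypothesis bs_size : size bs = n.+1.
Let L s := comb_val (take s bs).
Let R s := comb_val (drop s bs).
Let e s := comb_val [:: nth oneP1 bs s].
Hypothesis hom_LR : forall s, (0 < s <= n)%N ->
  phom x z (mu2 (L s) (R s)) /\ (mu2 (L s) (R s)).1 = D.
Hypothesis diff_L : forall s, (0 < s < n)%N ->
  bdiff (L s.+1) = pscale (-1) (mu2 (L s) (e s)).
Hypothesis diff_R : forall s, (0 < s < n)%N ->
  bdiff (R s) = pscale (-1) (mu2 (e s) (R s.+1)).

Fixpoint partial_sum (s : nat) : fam k :=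
  if s is s'.+1 then fadd (partial_sum s') (mu2 (L s) (R s)).2 else fam0 k.

Lemma partial_sum_hom s : (s <= n)%N -> is_hom x z D (partial_sum s).
Proof.
elim: s => [|s IH] sn; first exact: is_hom0.
apply: is_homD; first by apply: IH; apply: ltnW.
by have [] := hom_LR (s := s.+1) sn; rewrite /phom => hLR <-.
Qed.

Lemma partial_sum_p s c : (s <= n)%N ->
  p (partial_sum s) c = \sum_(t <- iota 1 s) p (mu2 (L t) (R t)).2 c.
Proof.
elim: s => [|s IH] sn; first by rewrite big_nil (p_fam0).
rewrite -[in iota _ _](addn1 s) iotaD big_cat big_seq1 add1n /= -IH ?(ltnW sn)
  //.
have [] := hom_LR (s := s.+1) sn; rewrite /phom => h eD; rewrite eD in h.
have := p_linear retract 1 (partial_sum_hom (ltnW sn)) h c.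
by rewrite fscale1 mul1r.
Qed.

(* The terms m_2(L s, m_2(e s, R (s + 1))) telescope, since every L (s + 1) and
   every R s bounds the product of its two factors. *)
Lemma partial_sum_diff s : (s <= n)%N ->
  dEnd D (partial_sum s) = fscale (sgn k D)
    (if (0 < s < n)%N then (mu2 (L s) (mu2 (e s) (R s.+1))).2 else fam0 k).
Proof.
elim: s => [|s IH] sn; first by rewrite /= dEnd0 fscale0.
rewrite [partial_sum _]/= dEndD IH ?(ltnW sn) //.
have [_ eD] := hom_LR (s := s.+1) sn.
have -> F : dEnd D F = fscale (sgn k D) (fscale (sgn k D) (dEnd D F)).
  by rewrite fscaleA sgnK fscale1.
have -> : fscale (sgn k D) (dEnd D (mu2 (L s.+1) (R s.+1)).2) =
    (bdiff (mu2 (L s.+1) (R s.+1))).2 by rewrite /bdiff eD.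
rewrite -fscale_add bdiff_mu2; congr fscale.
have -> : fscale (-1) (mu2 (L s.+1) (bdiff (R s.+1))).2 =
    (if (0 < s.+1 < n)%N then (mu2 (L s.+1) (mu2 (e s.+1) (R s.+2))).2
     else fam0 k).
  case: ifP => sn'.
    rewrite diff_R // /pscale mu2Zr -surjective_pairing fscaleA.
    by rewrite mulN1r opprK fscale1.
  (* At the last splitting the right factor is a single letter, hence a cycle; the same holds below
     for the left factor of the first splitting. *)
  have En : s.+1 = n by apply/eqP;
    rewrite eqn_leq sn leqNgt -[(_ < n)%N]/(0 < s.+1 < n)%N sn'.
  rewrite mu2_0r ?fscale0 // /R En.
  have -> : drop n bs = [:: nth oneP1 bs n].
    by rewrite (drop_nth oneP1) ?bs_size // drop_oversize ?bs_size.
  exact: bdiff1.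
have -> : fscale (sgn k (R s.+1).1) (mu2 (bdiff (L s.+1)) (R s.+1)).2 =
    fscale (-1) (if (0 < s < n)%N then (mu2 (L s) (mu2 (e s) (R s.+1))).2
     else fam0 k).
  case: ifP => sn'.
    rewrite diff_L // /pscale mu2Zl -surjective_pairing mu2A !fscaleA.
    by rewrite mulrN1 mulNr sgnK.
  have -> : s = 0%N by move: sn'; rewrite sn andbT; case: (s).
  rewrite mu2_0l ?fscale0 // /L.
  have -> : take 1 bs = [:: nth oneP1 bs 0].
    by case: (bs) bs_size => // b l _; rewrite /= take0.
  exact: bdiff1.
set A := if _ then _ else _; set B := if _ then _ else _.
by apply: fam_ext => *; rewrite /fadd /fscale scaleN1r addrC addrNK.
Qed.

End Telescope.

Lemma sum_take_drop s (bs : seq basis) : \sum_(b <- bs) deg b =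
  \sum_(b <- take s bs) deg b + \sum_(b <- drop s bs) deg b.
Proof. by rewrite -big_cat cat_take_drop. Qed.

(** A tree with n leaves has n - 1 branch points, and the edge above each of them carries one H of
    degree -1. *)
Lemma deg_edge T (bs : seq basis) : leaves T = size bs -> bs != [::] ->
  (edge T (tree_mu i H T bs)).1 = \sum_(b <- bs) deg b + 1 - (size bs)%:Z.
Proof.
elim: T bs => [|l IHl r IHr] bs lbs b0.
  by case: bs lbs b0 => [|b []] // _ _; rewrite big_seq1 /= addrK.
have st : size (take (leaves l) bs) = leaves l.
  by rewrite size_takel // -lbs leq_addr.
have sd : size (drop (leaves l) bs) = leaves r by rewrite size_drop -lbs addKn.
have t0 : take (leaves l) bs != [::] by rewrite -size_eq0 st -lt0n leaves_gt0.
have d0 : drop (leaves l) bs != [::] by rewrite -size_eq0 sd -lt0n leaves_gt0.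
rewrite -[LHS]/((edge l (tree_mu i H l (take (leaves l) bs))).1 +
  (edge r (tree_mu i H r (drop (leaves l) bs))).1 - 1).
rewrite IHl // IHr // st sd -lbs (sum_take_drop (leaves l) bs) /=; lia.
Qed.

(** One H fewer than in [deg_edge], since the root carries none; this is the degree 2 - d of m_d. *)
Lemma deg_split (bs : seq basis) s : (0 < s < size bs)%N ->
  (mu2 (comb_val (take s bs)) (comb_val (drop s bs))).1 =
  \sum_(b <- bs) deg b + 2 - (size bs)%:Z.
Proof.
move=> /andP[s0 sn];
  have st : size (take s bs) = s by rewrite size_takel ?(ltnW sn).
have sd : size (drop s bs) = (size bs - s)%N by rewrite size_drop.
have t0 : take s bs != [::] by rewrite -size_eq0 st -lt0n.
have d0 : drop s bs != [::] by rewrite -size_eq0 sd subn_eq0 -ltnNge.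
rewrite /= !deg_edge ?leaves_comb // st sd.
rewrite (sum_take_drop s bs) -subzn ?(ltnW sn) //; lia.
Qed.

Lemma m_op_pjs v r (d : nat) :
  equals_pm (m_op i p H (Bp v :: arrs v r ++
    [:: Bj (v (+) odd r); sx (v (+) odd d) (d + r).+1])) (sx (v (+) odd d) d).
Proof.
set bs := Bp v :: _.
have w1 := value1 (Bp v); have w2 := value_jx v r d.
have bs_size : size bs = r.+3 by rewrite /= size_cat size_arrs addn2.
have cb : composable bs.
  rewrite -[bs]cat1s composable_cat ?(val_neq0 w2) //.
  by rewrite (val_composable w2) (val_src w1) (val_tgt w2) eqxx.
have hom_LR s : (0 < s <= r.+2)%N ->
    phom (objS (v (+) odd d)) (objS v) (mu2 (comb_val (take s bs)) (comb_val
      (drop s bs))) /\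
    (mu2 (comb_val (take s bs)) (comb_val (drop s bs))).1 = d%:Z.
  move=> sn; have sn' : (0 < s < size bs)%N by rewrite bs_size.
  have [t0 d0 ct cd td] := composable_takedrop sn' cb.
  split; last first.
    rewrite deg_split // bs_size /bs big_cons big_cat /= !big_cons big_nil
      deg_sx.
    rewrite big1_seq ?add0r; first by rewrite /=; lia.
    by move=> b /= ba; move: ba; elim: (r) (v) => //= r' IH u;
      rewrite inE => /orP[/eqP->|/IH].
  have -> : objS (v (+) odd d) = bsrc (drop s bs).
    rewrite -(val_src w2) -(bsrc_cat [:: Bp v] (val_neq0 w2)).
    by rewrite -[[:: Bp v] ++ _]/bs -[in LHS](cat_take_drop s bs) bsrc_cat.
  have -> : objS v = btgt (take s bs) by case: (s) sn.
  apply: phom_mu2; last exact: (phom_comb_val t0 ct).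
  by rewrite td; apply: (phom_comb_val d0 cd).
have sx_drop : drop r.+2 bs = [:: sx (v (+) odd d) (d + r).+1].
  by rewrite /bs -cat1s -cat_rcons catA drop_size_cat //= size_rcons size_arrs.
have diff_L s : (0 < s < r.+2)%N -> bdiff (comb_val (take s.+1 bs)) =
    pscale (-1) (mu2 (comb_val (take s bs)) (comb_val [:: nth oneP1 bs s])).
  case: s => // s sr; have [h] := pjs_take v d (s := s) (r := r) sr.
  rewrite -/bs (take_nth oneP1) ?bs_size //; last by rewrite ltnW.
  exact: (lword_bdiff).
have diff_R s : (0 < s < r.+2)%N -> bdiff (comb_val (drop s bs)) =
    pscale (-1) (mu2 (comb_val [:: nth oneP1 bs s]) (comb_val (drop s.+1 bs))).
  case: s => // s sr; have := pjs_drop v d (s := s) (r := r) sr.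
  rewrite -/bs (drop_nth oneP1) ?bs_size; last by rewrite ltnW.
  exact: (rword_bdiff).
(* All other splits have no component that starts in degree -d. *)
have T0 s : (s <= r.+1)%N ->
    partial_sum bs s.+1 (objS (v (+) odd d)) (objS v) (- d%:Z) 0 =
    (mu2 (comb_val [:: Bp v]) (comb_val (drop 1 bs))).2 (objS (v (+) odd d))
      (objS v) (- d%:Z) 0.
  elim: s => [|s IH] sr; first by rewrite /= take0 drop0 add0f.
  rewrite -{}IH ?(ltnW sr) // -[RHS]addr0; congr (_ + _).
  have sn : (0 < s.+2 < size bs)%N by rewrite bs_size.
  have [t0 d0 _ cd _] := composable_takedrop sn cb.
  have bsrcE : bsrc (drop s.+2 bs) = objS (v (+) odd d).
    rewrite -(val_src w2) -(bsrc_cat [:: Bp v] (val_neq0 w2)).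
    by rewrite -[[:: Bp v] ++ _]/bs -[in RHS](cat_take_drop s.+2 bs) bsrc_cat.
  have hR := phom_comb_val d0 cd; rewrite bsrcE in hR.
  (* A right factor of degree greater than d maps degree -d to a positive degree, where all modules
     are zero. *)
  have dR : d%:Z < (comb_val (drop s.+2 bs)).1.
    move: sr; rewrite leq_eqVlt => /predU1P[[->]|sr].
      by rewrite sx_drop comb_val1 deg_sx /=; lia.
    have rw := pjs_drop v d (s := s.+1) (r := r) sr.
    have [-> _] := hword_val (or_intror rw).
    by have [_ _ ->] := hPSE (v (+) odd d) (d + s.+1); lia.
  rewrite /mu2 /= /fscale (fcomp_homE _ _ _ _ hR).
  rewrite [X in X *m _](mx_col0 _ (mdim_gt0 _ _ _)) ?mul0mx ?scaler0 //.
  lia.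
have pw : equals_pm (p (partial_sum bs r.+2)) (sx (v (+) odd d) d).
  have w1' : value [:: Bp v] (objP v) (objS v) 0 false by exact: w1.
  have [s es] := value_mu2_comp w1' w2 (mdim_P0 v).
  rewrite add0r in es.
  apply: (p_value (s := s) (x := objS (v (+) odd d)) (z := objS v) (d := d%:Z)).
  - by rewrite mem_ext_basis src_sx tgt_sx deg_sx -addbA addbb addbF !eqxx.
  - exact: (@partial_sum_hom _ _ _ bs r.+2 hom_LR r.+2 (leqnn _)).
  - move=> _; rewrite (@partial_sum_diff _ _ _ bs _ bs_size hom_LR diff_L
      diff_R r.+2 (leqnn _)).
    by rewrite ltnn andbF fscale0.
  rewrite T0 // cycle_shapeE src_sx tgt_sx deg_sx arrow_like_sx -addbA addbb
    addbF.
  by rewrite -es [drop 1 bs]/= drop0.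
have [s es] := pw; exists s => c; rewrite -es.
rewrite (m_op_splits) ?bs_size //.
by rewrite (@partial_sum_p _ _ _ bs r.+2 hom_LR r.+2 _ (leqnn _)).
Qed.

(** * Completeness of the list *)

(** Almost all pairs of letters outside the list are excluded because no basis element c has the
    required endpoints and degree. *)
Lemma split_gen_op1 g f c : composable [:: g; f] ->
  src c = src f -> tgt c = tgt g -> deg c = deg g + deg f ->
  p (mu2 (comb_val [:: g]) (comb_val [:: f])).2 c != 0 ->
  has is_id [:: g; f] \/ exists c', gen_op [:: g; f] c'.
Proof.
rewrite [composable _]/= => /andP[/eqP gf _] sc tc dc pc.
have nself (u : vertex) : u <> ~~ u by case: u.
have [fx|nf] := boolP (is_ext f).
  have [v [d fE]] := sx_surj fx; subst f;
    rewrite tgt_sx src_sx deg_sx in gf sc dc.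
  have [gx|ng] := boolP (is_ext g).
    have [w [e gE]] := sx_surj gx; subst g; rewrite src_sx in gf.
    by case: gf => ->; right; exists (sx v (e + d)); apply: gen_op_ss.
  case: g gf tc dc ng {pc} => // u _ /= tc dc _.
  have [] := ext_SP sc tc; rewrite dc add0r => -[-> _].
  by left; rewrite /= is_id_sx0 orbT.
have [gx|ng] := boolP (is_ext g).
  have [v [d gE]] := sx_surj gx; subst g;
    rewrite tgt_sx src_sx deg_sx in gf tc dc.
  case: f gf sc dc nf {pc} => // u _ /= sc dc _.
  have [] := ext_PS sc tc; rewrite dc addr0 => -[-> _].
  by left; rewrite /= is_id_sx0.
case: g f gf sc tc dc pc nf ng => [v|v|v|v|v n|v n] [u|u|u|u|u m|u m] // gf sc
  tc dc pc _ _;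
  rewrite /= in gf sc tc dc.
- have [n] := ext_SS sc tc; rewrite dc => -[<-]; case: gf => ->.
  by rewrite /= addbF => /nself.
- have [_] := ext_PS sc tc; case: gf => ->.
  by case: (u).
- by left; rewrite /= is_id_B1 ?orbT.
- by right; exists (Ba (~~ v)); case: gf => <-; apply: gen_op_jp.
- have [_] := ext_SP sc tc; case: gf => ->.
  by case: (u).
(* Two arrows: the endpoints and the degree admit the identity of a P, so here the product itself
   has to vanish. *)
- by move: pc; rewrite (mu2_arrow0) // (p_fam0) eqxx.
- by left; rewrite /= is_id_B1 ?orbT.
- by left; rewrite /= is_id_B1 ?orbT.
- by left; rewrite /= is_id_B1 ?orbT.
- by left; rewrite /= is_id_B1 ?orbT.
Qed.

(** An [lword] has a value of negative degree, which must be balanced by an element of Ext^*(S, S)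
    or by an [rword]. Unless both ends are S, Ext^* lives in degree 0, and this fixes the remaining
    parameter. *)
Lemma split_gen_op b1 b2 c : admissible b1 -> admissible b2 ->
  composable (b1 ++ b2) ->
  src c = bsrc b2 -> tgt c = btgt b1 ->
    deg c = (comb_val b1).1 + (comb_val b2).1 ->
  p (mu2 (comb_val b1) (comb_val b2)).2 c != 0 ->
  (size (b1 ++ b2) = 2%N /\ has is_id (b1 ++ b2)) \/
  exists c', gen_op (b1 ++ b2) c'.
Proof.
move=> g1 g2 cb sc tc dc pc.
have nself (u : vertex) : u <> ~~ u by case: u.
have dc0 := deg_ge0 c.
have := cb; rewrite composable_cat ?admissible_neq0 // => /and3P[c1 c2 /eqP st].
have deg_word b h : hword b h -> (comb_val b).1 = hdeg h.
  by case/(hword_val).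
case: g1 c1 tc st cb dc pc => [[g ->]|[h1 w1]] c1 tc st cb dc pc;
  case: g2 c2 sc st cb dc pc => [[f ->]|[h2 w2]] c2 sc st cb dc pc.
- rewrite !comb_val1 in dc.
  by case: (split_gen_op1 cb sc tc dc pc); [left|right].
- right; have [_ s2 t2] := hwordP w2;
    rewrite (deg_word _ _ w2) comb_val1 /= in dc.
  rewrite s2 in sc; rewrite t2 in st; rewrite /btgt /= in tc;
    rewrite /bsrc /= in st.
  clear pc cb c1 c2 s2 t2.
  case: w2 => [[v r|v r]|[v r d]] in dc sc st *.
  + have [hs ht hd] := hSPE v r.+1; rewrite hs ht hd in sc st dc.
    case: g tc st dc => // [u|u n|u n] /= tc [st] dc.
    * by have := ext_PP sc tc; lia.
    * have [] := ext_PS sc tc; rewrite dc => de _; subst u.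
      exists (Bp (v (+) odd r.+1)); have := gen_op_sp v r.+1.
      by have {1}-> : r.+1 = n.*2; [lia|rewrite sx_even].
    * have [] := ext_PS sc tc; rewrite dc => de _; subst u.
      exists (Bp (v (+) odd r.+1)); have := gen_op_sp v r.+1.
      by have {1}-> : r.+1 = n.*2.+1; [lia|rewrite sx_odd].
  + have [hs ht hd] := hSSE v r.+1; rewrite hs ht hd in sc st dc.
    have [gx|ng] := boolP (is_ext g); last first.
      by have := ext_SP sc;
        case: g tc st dc ng => // u /= tc st dc _ /(_ _ tc)[]; lia.
    have [u [n gE]] := sx_surj gx; subst g; rewrite src_sx deg_sx in st dc.
    case: st => <-; have [d dE] : exists d, n =
      (d + r).+1 by exists (n - r.+1)%N; lia.
    by exists (sx (~~ (u (+) odd r)) d); rewrite dE; apply: gen_op_spj.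
  have [hs ht hd] := hPSE (v (+) odd d) d.
  rewrite hs ht hd -addbA addbb addbF in sc st dc.
  case: g tc st dc => // u /= tc [st] dc; rewrite st in tc *.
  + by exists (sx (v (+) odd d) d); apply: gen_op_pjs.
  + have [] := ext_SP sc tc; rewrite dc => d0 _.
    have {d0} -> : d = 0%N by lia.
    exists (Bj (~~ v)); have := gen_op_ajs (~~ v) r.
    by rewrite /= !negbK addbF !addNb addbN negbK.
  + have [] := ext_SP sc tc; rewrite dc => d0.
    by have -> : d = 0%N; [lia|rewrite addbF => /nself].
- right; have [_ s1 t1] := hwordP w1;
    rewrite (deg_word _ _ w1) comb_val1 /= in dc.
  rewrite t1 in tc; rewrite s1 in st; rewrite /bsrc /= in sc;
    rewrite /btgt /= in st.
  clear pc cb c1 c2 s1 t1.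
  have fpos : ~~ is_ext f -> deg f = 0 by case: (f).
  case: w1 => [[v r|v r]|[v r d]] in dc tc st *.
  + have [hs ht hd] := hSPE v r.+1; rewrite hs ht hd in tc st dc.
    have [fx|nf] := boolP (is_ext f); last by rewrite fpos // in dc; lia.
    by case: f fx st {sc dc fpos}.
  + have [hs ht hd] := hSSE v r.+1; rewrite hs ht hd in tc st dc.
    have [fx|nf] := boolP (is_ext f); last by rewrite fpos // in dc; lia.
    have [u [n fE]] := sx_surj fx; subst f; rewrite tgt_sx deg_sx in st dc.
    case: st => uv; have [d dE] : exists d, n =
      (d + r).+1 by exists (n - r.+1)%N; lia.
    by exists (sx (v (+) odd d) d); apply: gen_op_cat_pjs.
  have [hs ht hd] := hPSE (v (+) odd d) d.
  rewrite hs ht hd in tc st dc; rewrite -addbA addbb addbF in tc.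
  have [fx|nf] := boolP (is_ext f).
    have [u [n fE]] := sx_surj fx; subst f;
      rewrite tgt_sx src_sx deg_sx in sc st dc.
    have [] := ext_SP sc tc; rewrite dc => d0 vu; case: st.
    have [-> ->] : d = 0%N /\ n = 0%N by lia.
    by rewrite /= !addbF vu => /esym/nself.
  case: f sc st dc nf {fpos} => // u /= sc [st] dc _.
  have := ext_PP sc tc; rewrite dc => d0; have {d0 dc} d0 : d = 0%N by lia.
  subst d; exists (B1 v); have := gen_op_ajsp v r 0.
  by rewrite -st -catA.
right; have [_ s1 t1] := hwordP w1; have [_ s2 t2] := hwordP w2.
rewrite (deg_word _ _ w1) (deg_word _ _ w2) in dc.
rewrite t1 in tc; rewrite s1 t2 in st; rewrite s2 in sc.
clear pc cb c1 c2 s1 t1 s2 t2.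
case: w1 => [[v r|v r]|[v r d]] in dc tc st *;
  [have [s1 t1 d1] := hSPE v r.+1 | have [s1 t1 d1] := hSSE v r.+1
  | have [s1 t1 d1] := hPSE (v (+) odd d) d];
  rewrite s1 in st; rewrite t1 in tc; rewrite d1 in dc;
  (case: w2 => [[w s|w s]|[w s e]] in dc sc st *;
  [have [s2 t2 d2] := hSPE w s.+1 | have [s2 t2 d2] := hSSE w s.+1
  | have [s2 t2 d2] := hPSE (w (+) odd e) e];
  rewrite s2 in sc; rewrite t2 in st; rewrite d2 in dc; try by [|lia]).
(* Of the nine pairs of longer words only three have matching endpoints and a non-negative degree,
   and the third fails on its vertices. *)
- case: st; rewrite -addbA addbb addbF => vw.
  have [n _ dE] := ext_SS sc tc.
  (* The left factor has degree -(r + 1), so m is the degree of the product. *)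
  have [m mE] : exists m, e = (m + r.+1)%N by exists (e - r.+1)%N; lia.
  exists (sx (v (+) odd m) m); subst w.
  apply: gen_op_eq (gen_op_pjs v (r.+1 + s) m) _ (erefl _); rewrite cat_cons mE.
  rewrite arrs_cat -catA; congr (_ :: _ ++ _ ++ [:: Bj _; _]).
    by rewrite oddD addbA.
  rewrite addnA; congr sx.
  by rewrite oddD [odd m (+) _]addbC -!addbA addKb.
- case: st => vw; subst w; have := ext_PP sc tc; rewrite dc => d0.
  have {d0 dc} d0 : d = s.+1 by lia.
  subst d; exists (B1 v); rewrite -catA; exact: (gen_op_ajsp v r s.+1).
case: st => vw; subst w; have [] := ext_SP sc tc; rewrite dc => d0.
have {d0 dc} d0 : d = s.+1 by lia.
by subst d => /nself.
Qed.

Lemma m_op_gen_op bs c : gen_op bs c -> equals_pm (m_op i p H bs) c.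
Proof.
case=> [v|v d e|v r|v r d|v r d|v r|v r s].
- exact: (m_op_jp).
- exact: (m_op_ss).
- exact: (m_op_sp).
- exact: (m_op_spj).
- exact: (m_op_pjs).
- exact: (m_op_ajs).
- exact: (m_op_ajsp).
Qed.

Lemma m_op1 b c : m_op i p H [:: b] c = 0.
Proof. by rewrite /m_op (i_cycle retract) fscale0 (p_fam0). Qed.

Lemma gen_op_of_m_op bs c : composable bs -> m_op i p H bs c != 0 ->
  (size bs = 2%N /\ has is_id bs) \/ exists c', gen_op bs c'.
Proof.
case: bs => [|b1 [|b2 bs]]; rewrite ?m_op1 ?eqxx //.
  by rewrite /m_op big_nil eqxx.
set w := _ :: _ => cw; rewrite (m_op_splits) // => nz.
have [s sw ps] : exists2 s, s \in iota 1 (size w).-1 &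
    p (mu2 (comb_val (take s w)) (comb_val (drop s w))).2 c != 0.
  apply/hasP; apply: contraNT nz => /hasPn z0.
  by rewrite big1_seq // => s /= /z0; rewrite negbK => /eqP.
have sn : (0 < s < size w)%N by move: sw; rewrite mem_iota add1n.
have [gt gd] := p_split_admissible sn cw ps.
have [t0 d0 ct cd td] := composable_takedrop sn cw.
have hm : phom (bsrc (drop s w)) (btgt (take s w))
    (mu2 (comb_val (take s w)) (comb_val (drop s w))).
  apply: phom_mu2; last exact: (phom_comb_val t0 ct).
  by rewrite td; apply: (phom_comb_val d0 cd).
have := contraNT _ ps; move=> /(_ (c \in ext_basis (bsrc (drop s w))
  (btgt (take s w)) (mu2 (comb_val (take s w)) (comb_val (drop s w))).1)).
case: (boolP (c \in _)) => [|nc _]; last first.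
  by rewrite (p_hom retract hm nc) eqxx in ps.
rewrite mem_ext_basis => /and3P[/eqP sc /eqP tc /eqP dc] _.
have := split_gen_op gt gd; rewrite cat_take_drop => /(_ c cw sc tc dc ps).
by [].
Qed.

(** * Identity morphisms *)

Lemma fcomp_idr x y d (f : fam k) : is_hom x y d f ->
  fcomp 0 f (id_fam k x x 0) = f.
Proof.
(* That [id_fam] is a morphism is inherited from the chosen cycle, which for an identity is [id_fam]
   exactly and not only up to signs. *)
move=> hf; have hid := i_hom retract (id_basis x).
have := proj2 cycles x => idE; rewrite idE in hid.
have {}hid : is_hom x x 0 (id_fam k x x 0) by case: (x) hid.
apply: fam_ext => x' z n m; have [->|x'x] := eqVneq x' x.
  rewrite (fcomp_homE _ _ _ _ hid) /id_fam ifT ?eqxx //.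
  by rewrite addr0 pid_mx_1 mul1mx.
rewrite (proj1 hf) ?(negbTE x'x) // (proj1 (is_hom_comp hid hf)) //.
by rewrite (negbTE x'x).
Qed.

Lemma fcomp_idl x y d (f : fam k) : is_hom x y d f ->
  fcomp d (id_fam k y y 0) f = f.
Proof.
move=> hf; have hid := i_hom retract (id_basis y).
have := proj2 cycles y => idE; rewrite idE in hid.
have {}hid : is_hom y y 0 (id_fam k y y 0) by case: (y) hid.
apply: fam_ext => x' z n m.
have [/and3P[/eqP-> /eqP-> /eqP->]|nz] :=
  boolP [&& x' == x, z == y & m == n + d]; last first.
  by rewrite (proj1 hf) // (proj1 (is_hom_comp hf hid)) // addr0.
rewrite (fcomp_homE _ _ _ _ hf) /id_fam ifT ?addr0 ?eqxx //.
by rewrite pid_mx_1 mulmx1.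
Qed.

Lemma deg_id_basis x : deg (id_basis x) = 0.
Proof. by case: x. Qed.

Lemma src_id_basis x : src (id_basis x) = x.
Proof. by case: x. Qed.

Lemma tgt_id_basis x : tgt (id_basis x) = x.
Proof. by case: x. Qed.

Lemma m_op2 g f c : src g = tgt f -> m_op i p H [:: g; f] c =
  sgn k (deg f) * p (fcomp (deg f) (i g) (i f)) c.
Proof.
move=> gf; rewrite (m_op_splits) /=; last by [].
  rewrite big_seq1 /= !comb_val1 /=.
  have hf := i_hom retract f; have hg := i_hom retract g; rewrite gf in hg.
  exact: (p_scale _ _ (is_hom_comp hf hg)).
by rewrite gf eqxx.
Qed.

Lemma m_op_id b c :
  m_op i p H [:: b; id_basis (src b)] c = (b == c)%:R /\
  sgn k (deg b) * m_op i p H [:: id_basis (tgt b); b] c = (b == c)%:R.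
Proof.
have hb := i_hom retract b; split.
  rewrite m_op2 ?tgt_id_basis // deg_id_basis (proj2 cycles) (fcomp_idr hb).
  by rewrite (pi_id retract) mul1r.
rewrite m_op2 ?src_id_basis // (proj2 cycles) (fcomp_idl hb).
by rewrite (pi_id retract) mulrA sgnK mul1r.
Qed.

End Transfer.

Theorem theorem4p9 (k : fieldType) (i : basis -> fam k)
    (p : fam k -> basis -> k) (H : fam k -> fam k)
    (Hretract : homotopy_retract i p H) (Hcycles : chosen_cycles i)
    (Hhomotopy : chosen_homotopy i H) :
  (forall b c, m_op i p H [:: b] c = 0) /\
  (forall b c,
     m_op i p H [:: b; id_basis (src b)] c = (b == c)%:R /\
     sgn k (deg b) * m_op i p H [:: id_basis (tgt b); b] c = (b == c)%:R) /\
  (forall bs c, in_list bs c -> equals_pm (m_op i p H bs) c) /\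
  (forall bs, composable bs -> (exists c, m_op i p H bs c != 0) ->
     (size bs = 2%N /\ has is_id bs) \/ (exists c, in_list bs c)).
Proof.
split; first exact: (m_op1 Hretract).
split; first exact: (m_op_id Hretract Hcycles Hhomotopy).
split=> [bs c /gen_op_of_in_list|bs cb [c nz]].
  exact: (m_op_gen_op Hretract Hcycles Hhomotopy).
have [|[c' /in_list_of_gen_op]] :=
  gen_op_of_m_op Hretract Hcycles Hhomotopy cb nz.
  by left.
by right; exists c'.
Qed.
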